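(* Consider the system $\dot x=f_0(x)+\epsilon f_1(x,t;\epsilon)$ on $\mathcal D\subseteq\mathbb R^N$ under the standing assumptions of the context, let $z_0^*=(I_0^*,\theta_0^* )$ satisfy the existence conditions stated in the context, let $x(t,x_0^*(\epsilon))$ be the corresponding family of periodic solutions, with $x_0^*(0)=x_0^*=G(z_0^* )$, and let $A(t;\epsilon)$ be the $nT$-periodic matrix defined in the context. For $t_0\in\mathbb R$ put $$\lambda_\epsilon=\frac{1}{nT}\int_{t_0}^{t_0+nT}\mathrm{Tr}\left[A(t;\epsilon)\right]dt,$$ where $\mathrm{Tr}$ denotes the trace. Then for each sufficiently small $\epsilon$, $0<\epsilon^2\ll1$: if $\lambda_\epsilon>0$, the periodic solution $x(t,x_0^*(\epsilon))$ is unstable.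
   Context: Setting. $\mathcal D\subseteq\mathbb R^N$ is open, $f_0\in\mathcal C^2(\mathcal D;\mathbb R^N)$, $f_1\in\mathcal C^2(\mathcal D\times\mathbb R\times(-\delta,\delta);\mathbb R^N)$ for some $\delta>0$, and $f_1$ is $T$-periodic in $t$ ($T>0$). The unperturbed system $\dot x=f_0(x)$ is completely integrable: it has $N-1$ functionally independent first integrals $I_1,\dots,I_{N-1}$, defined and not locally constant on $\mathcal D$, such that $I=(I_1,\dots,I_{N-1}):\mathcal D\to\Lambda:=I(\mathcal D)\subset\mathbb R^{N-1}$ is a smooth submersion. Standing assumptions. (1) Each preimage $I^{-1}(\xi)$, $\xi\in\Lambda$, is a union of disjoint closed curves, each entirely traversed by a periodic solution of $\dot x=f_0(x)$. (2) The period $P(x_0)>0$ of the orbit through $x_0$ is a $\mathcal C^1$ function of $x_0\in\mathcal D$. (3) There are $x_0\in\mathcal D$ and nonzero $m,n\in\mathbb N$ with $mP(x_0)=nT$. (4) There is a smooth $(N-1)$-dimensional submanifold $\mathcal D_0\subset\mathcal D$ which every non-trivial solution of $\dot x=f_0(x)$ intersects transversally in exactly one point; the intersection of $I^{-1}(\xi)$ with $\mathcal D_0$ is denoted $x_0(\xi)$, so that points $x_0\in\mathcal D_0$ and values $\xi\in\Lambda$ are in one-to-one correspondence. Notation. For $I\in\Lambda$, $q(t,I)$ is the solution of $\dot x=f_0(x)$ with $q(0,I)=x_0(I)$; $P(I):=P(x_0(I))$; $\Omega(I):=T/P(I)$. With $S^1=\mathbb R/T\mathbb Z$, define $G(I,\theta):=q\big(\tfrac{P(I)}{T}\theta,\,I\big)$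 for $(I,\theta)\in\Lambda\times S^1$; $G$ is taken to be a diffeomorphism from $\Lambda\times S^1$ onto $\mathcal D$. Melnikov functions. For $(I_0,\theta_0)$ put $g(t)=G(I_0,\theta_0+\Omega(I_0)t)$. For $i=1,\dots,N-1$, $$M_i(I_0,\theta_0)=\int_0^{nT}DI_i(g(t))\cdot f_1(g(t),t;0)\,dt,$$ and (used in the degenerate case) $$M_N(I_0,\theta_0)=\int_0^{nT}\left[\frac{f_0(g(t))\cdot f_1(g(t),t;0)}{|f_0(g(t))|^2}-\sum_{i=1}^{N-1}\frac{f_0(g(t))\cdot G_{I_i}(I_0,\theta_0+\Omega(I_0)t)}{|f_0(g(t))|^2}\;DI_i(g(t))\cdot f_1(g(t),t;0)\right]dt .$$ Existence conditions. $m\,P(I_0^* )=n\,T$ for nonzero $m,n\in\mathbb N$, and either (a) $\frac{d\Omega}{dI}(I_0^* )\ne0$, $M_i(I_0^*,\theta_0^* )=0$ for $i=1,\dots,N-1$ and $\det\frac{\partial(M_1,\dots,M_{N-1},\Omega)}{\partial(I_0,\theta_0)}(I_0^*,\theta_0^* )\neq0$; or (b) $\frac{d\Omega}{dI}(I_0^* )=0$, $M_i(I_0^*,\theta_0^* )=0$ for $i=1,\dots,N$ and $\det\frac{\partial(M_1,\dots,M_N)}{\partial(I_0,\theta_0)}(I_0^*,\theta_0^* )\neq0$. Family of periodic solutions. $x(t,x_0^*(\epsilon))$ denotes the $nT$-periodic solutions of $\dot x=f_0(x)+\epsilon f_1(x,t;\epsilon)$ for small $\epsilon$, with initial values $x_0^*(\epsilon)$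 at $t=0$ bifurcating from $x_0^*(0)=x_0^*=G(z_0^* )$ (they correspond to fixed points of the $n$-th iterate of the time-$T$ Poincaré map near $z_0^*$). Here $x(t,x_0^* )$ is the unperturbed ($\epsilon=0$) periodic solution, and $x_1(t,x_0^* )$ is the first-order coefficient in the expansion $$x(t,x_0^*(\epsilon))=x(t,x_0^* )+\epsilon\,x_1(t,x_0^* )+\mathcal O(\epsilon^2).$$ The matrix $A$. With $f_{10}(x,t):=f_1(x,t;0)$, $$A(t;\epsilon)=\frac{\partial f_0}{\partial x}(x(t,x_0^* ))+\epsilon\left(\frac{\partial f_{10}}{\partial x}(x(t,x_0^* ),t)+\frac{\partial^2 f_0}{\partial x^2}(x(t,x_0^* ))\,x_1(t,x_0^* )\right),$$ where $\frac{\partial^2 f_0}{\partial x^2}x_1$ is the matrix with $(i,j)$ entry $\sum_k\frac{\partial^2 f_{0,i}}{\partial x_j\partial x_k}x_{1,k}$. Instability is meant in the sense of Lyapunov for the non-autonomous system. *)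

(* Defs.v *)
From HB Require Import structures.
From mathcomp Require Import all_boot all_order all_algebra.
From mathcomp Require Import all_classical all_reals all_analysis.

Set Implicit Arguments.
Unset Strict Implicit.
Unset Printing Implicit Defensive.

Import Order.TTheory GRing.Theory Num.Theory.
Import numFieldNormedType.Exports.

Local Open Scope classical_set_scope.
Local Open Scope ring_scope.

(* The phase space has dimension N = p.+1, so that p = N - 1; points are row
   vectors. *)

(* Class C^k on an open set of a finite-dimensional space. *)
Fixpoint class_C (R : realType) (V W : normedModType R) (k : nat)
    (f : V -> W) (U : set V) : Prop :=
  match k with
  | 0 => forall x, U x -> {for x, continuous f}
  | j.+1 => (forall x, U x -> differentiable f x) /\
            forall v, class_C j (fun x => 'D_v f x) U
  end.

Definition smooth (R : realType) (V W : normedModType R)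
    (f : V -> W) (U : set V) : Prop :=
  forall k, class_C k f U.

(* The derivative is two-sided also at an end point of J: this only asks that x
   be extended across the end point, which is always possible (affinely). *)
Definition solution (R : realType) (V : normedModType R) (D : set V)
    (F : R -> V -> V) (J : set R) (x : R -> V) : Prop :=
  forall t, J t -> D (x t) /\ is_derive t 1 x (F t (x t)).

Definition first_integral (R : realType) (V : normedModType R) (D : set V)
    (f : V -> V) (J : V -> R) : Prop :=
  forall a b x, solution D (fun=> f) `]a, b[ x ->
  forall s t, s \in `]a, b[ -> t \in `]a, b[ -> J (x s) = J (x t).

Definition locally_constant_somewhere (R : realType) (V : normedModType R)
    (D : set V) (J : V -> R) : Prop :=
  exists U : set V, [/\ open U, U !=set0, U `<=` D &
    forall x y, U x -> U y -> J x = J y].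

Definition submersion (R : realType) (V W : normedModType R)
    (D : set V) (f : V -> W) : Prop :=
  forall x, D x -> differentiable f x /\ range ('d f x) = [set: W].

(* Functional independence of the components of I is contained in the
   submersion property. *)
Definition completely_integrable (R : realType) (p : nat)
    (D : set 'rV[R]_p.+1) (f0 : 'rV[R]_p.+1 -> 'rV[R]_p.+1)
    (I : 'rV[R]_p.+1 -> 'rV[R]_p) : Prop :=
  [/\ forall i, first_integral D f0 (fun x => I x 0 i),
      forall i, ~ locally_constant_somewhere D (fun x => I x 0 i),
      smooth I D & submersion D I].

Definition minimal_period (R : realType) (V : zmodType) (x : R -> V) (tau : R) :
    Prop :=
  [/\ 0 < tau, periodic x tau & forall s, 0 < s < tau -> ~ periodic x s].

(* A constant solution has no minimal period, hence c is a genuine closed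
   curve. *)
Definition periodic_orbit (R : realType) (V : normedModType R) (D : set V)
    (f0 : V -> V) (c : set V) : Prop :=
  exists x tau, [/\ solution D (fun=> f0) setT x, minimal_period x tau &
                    c = range x].

Definition level_set (R : realType) (p : nat) (D : set 'rV[R]_p.+1)
    (I : 'rV[R]_p.+1 -> 'rV[R]_p) (xi : 'rV[R]_p) : set 'rV[R]_p.+1 :=
  D `&` I @^-1` [set xi].

Definition levels_of_closed_orbits (R : realType) (p : nat)
    (D : set 'rV[R]_p.+1) (f0 : 'rV[R]_p.+1 -> 'rV[R]_p.+1)
    (I : 'rV[R]_p.+1 -> 'rV[R]_p) : Prop :=
  forall xi, (I @` D) xi -> exists C : set (set 'rV[R]_p.+1),
    [/\ forall c, C c -> periodic_orbit D f0 c, trivIset C id &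
        level_set D I xi = \bigcup_(c in C) c].

Definition C1_period (R : realType) (V : normedModType R) (D : set V)
    (f0 : V -> V) (P : V -> R) : Prop :=
  class_C 1 P D /\
  forall x, solution D (fun=> f0) setT x -> minimal_period x (P (x 0)).

(* h is a regular equation of the hypersurface M on the neighbourhood U. *)
Definition defining_function (R : realType) (V : normedModType R) (M : set V)
    (U : set V) (h : V -> R) : Prop :=
  [/\ open U, smooth h U, forall y, U y -> exists v, 'D_v h y != 0 &
      M `&` U = [set y | U y /\ h y = 0]].

Definition smooth_hypersurface (R : realType) (V : normedModType R)
    (M : set V) : Prop :=
  forall y, M y -> exists U h, U y /\ defining_function M U h.

Definition tangent_space (R : realType) (V : normedModType R) (M : set V)
    (y : V) : set V :=
  [set v | forall U h, U y -> defining_function M U h -> 'D_v h y = 0].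

Definition global_section (R : realType) (V : normedModType R) (D : set V)
    (f0 : V -> V) (D0 : set V) : Prop :=
  [/\ D0 `<=` D, smooth_hypersurface D0 &
      forall x, solution D (fun=> f0) setT x -> (exists s t, x s <> x t) ->
      exists y, range x `&` D0 = [set y] /\ ~ tangent_space D0 y (f0 y)].

(* A map on L x S^1, S^1 = R / T Z, is represented by its lift to L x R, which
   is T-periodic in the second variable.  Bijectivity is modulo T Z, and the
   last clause says that the inverse, read through local lifts D -> L x R, is
   of class C^1. *)
Definition circle_diffeomorphism (R : realType) (p : nat) (T : R)
    (L : set 'rV[R]_p) (D : set 'rV[R]_p.+1)
    (G : 'rV[R]_p * R -> 'rV[R]_p.+1) : Prop :=
  [/\ forall J, L J -> periodic (fun th => G (J, th)) T,
      G @` (L `*` setT) = D,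
      forall z w, L z.1 -> L w.1 -> G z = G w ->
        z.1 = w.1 /\ exists k : int, z.2 - w.2 = k%:~R * T,
      class_C 1 G (L `*` setT) &
      forall y, D y -> exists (U : set 'rV[R]_p.+1) H,
        [/\ open U, U y, U `<=` D, class_C 1 H U &
            forall u, U u -> L (H u).1 /\ G (H u) = u]].

Definition dotv (R : realType) (k : nat) (u v : 'rV[R]_k) : R :=
  \sum_i u 0 i * v 0 i.

Definition frequency (R : realType) (p : nat) (T : R) (P : 'rV[R]_p.+1 -> R)
    (x0 : 'rV[R]_p -> 'rV[R]_p.+1) (J : 'rV[R]_p) : R :=
  T / P (x0 J).

(* q J t is the value at time t of the unperturbed solution started at x0 J. *)
Definition action_angle (R : realType) (p : nat) (T : R)
    (P : 'rV[R]_p.+1 -> R) (x0 : 'rV[R]_p -> 'rV[R]_p.+1)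
    (q : 'rV[R]_p -> R -> 'rV[R]_p.+1) (z : 'rV[R]_p * R) : 'rV[R]_p.+1 :=
  q z.1 (P (x0 z.1) / T * z.2).

(* In the next two definitions tau stands for n T, and Om for the function
   Omega. *)
Definition melnikov (R : realType) (p : nat) (tau : R)
    (f1 : 'rV[R]_p.+1 -> R -> R -> 'rV[R]_p.+1) (I : 'rV[R]_p.+1 -> 'rV[R]_p)
    (Om : 'rV[R]_p -> R) (G : 'rV[R]_p * R -> 'rV[R]_p.+1)
    (z : 'rV[R]_p * R) : 'rV[R]_p :=
  \row_i \int[lebesgue_measure]_(t in `[0, tau])
    (let g := G (z.1, z.2 + Om z.1 * t) in 'd I g (f1 g t 0) 0 i).

Definition melnikov_last (R : realType) (p : nat) (tau : R)
    (f0 : 'rV[R]_p.+1 -> 'rV[R]_p.+1)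
    (f1 : 'rV[R]_p.+1 -> R -> R -> 'rV[R]_p.+1) (I : 'rV[R]_p.+1 -> 'rV[R]_p)
    (Om : 'rV[R]_p -> R) (G : 'rV[R]_p * R -> 'rV[R]_p.+1)
    (z : 'rV[R]_p * R) : R :=
  \int[lebesgue_measure]_(t in `[0, tau])
    (let th := z.2 + Om z.1 * t in
     let g := G (z.1, th) in
     dotv (f0 g) (f1 g t 0) / dotv (f0 g) (f0 g) -
     \sum_(i < p)
       dotv (f0 g) ('D_(delta_mx 0 i) (fun J => G (J, th)) z.1)
         / dotv (f0 g) (f0 g) * 'd I g (f1 g t 0) 0 i).

Definition gradient (R : realType) (k : nat) (h : 'rV[R]_k -> R)
    (y : 'rV[R]_k) : 'rV[R]_k :=
  \row_i 'D_(delta_mx 0 i) h y.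

Definition pack (R : realType) (p : nat) (z : 'rV[R]_p * R) : 'rV[R]_(p + 1) :=
  row_mx z.1 z.2%:M.

Definition unpack (R : realType) (p : nat) (w : 'rV[R]_(p + 1)) :
    'rV[R]_p * R :=
  (lsubmx w, rsubmx w 0 0).

(* 'J is the transpose of the usual Jacobian matrix, with the same
   determinant.  Differentiability is required because 'J is a total function
   with a junk value where the derivatives do not exist. *)
Definition nonzero_jacobian (R : realType) (p : nat)
    (F : 'rV[R]_p * R -> 'rV[R]_p * R) (z : 'rV[R]_p * R) : Prop :=
  differentiable F z /\
  \det ('J (fun w => pack (F (unpack w))) (pack z)) != 0.

Definition existence_conditions (R : realType) (p : nat) (T : R)
    (L : set 'rV[R]_p) (f0 : 'rV[R]_p.+1 -> 'rV[R]_p.+1)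
    (f1 : 'rV[R]_p.+1 -> R -> R -> 'rV[R]_p.+1) (I : 'rV[R]_p.+1 -> 'rV[R]_p)
    (P : 'rV[R]_p.+1 -> R) (x0 : 'rV[R]_p -> 'rV[R]_p.+1)
    (q : 'rV[R]_p -> R -> 'rV[R]_p.+1) (m n : nat) (z : 'rV[R]_p * R) : Prop :=
  let Om := frequency T P x0 in
  let G := action_angle T P x0 q in
  let M := melnikov (n%:R * T) f1 I Om G in
  let MN := melnikov_last (n%:R * T) f0 f1 I Om G in
  [/\ L z.1, m != 0%N, n != 0%N, m%:R * P (x0 z.1) = n%:R * T &
      [/\ gradient Om z.1 != 0, M z = 0 &
          nonzero_jacobian (fun w => (M w, Om w.1)) z] \/
      [/\ gradient Om z.1 = 0, M z = 0, MN z = 0 &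
          nonzero_jacobian (fun w => (M w, MN w)) z]].

Definition perturbed (R : realType) (V : normedModType R) (f0 : V -> V)
    (f1 : V -> R -> R -> V) (eps : R) : R -> V -> V :=
  fun t x => f0 x + eps *: f1 x t eps.

(* The expansion is required for each t separately. *)
Definition periodic_family (R : realType) (V : normedModType R) (D : set V)
    (f0 : V -> V) (f1 : V -> R -> R -> V) (tau : R) (xstar : V)
    (x : R -> R -> V) (x1 : R -> V) : Prop :=
  [/\ \forall eps \near (0 : R),
        solution D (perturbed f0 f1 eps) setT (x eps) /\ periodic (x eps) tau,
      x 0 0 = xstar &
      forall t, (fun eps : R => x eps t - x 0 t - eps *: x1 t)
        =O_ (0 : R) (fun eps : R => eps ^+ 2)].

(* xb is the unperturbed periodic solution; 'J is transposed to obtain the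
   usual convention for the Jacobian matrix. *)
Definition variational_matrix (R : realType) (N : nat)
    (f0 : 'rV[R]_N -> 'rV[R]_N) (f1 : 'rV[R]_N -> R -> R -> 'rV[R]_N)
    (xb x1 : R -> 'rV[R]_N) (t eps : R) : 'M[R]_N :=
  ('J f0 (xb t))^T +
  eps *: (('J (fun y => f1 y t 0) (xb t))^T +
          \matrix_(i, j) \sum_k
            'D_(delta_mx 0 k) (fun y => 'D_(delta_mx 0 j) f0 y) (xb t) 0 i
            * x1 t 0 k).

Definition lambda (R : realType) (N : nat) (f0 : 'rV[R]_N -> 'rV[R]_N)
    (f1 : 'rV[R]_N -> R -> R -> 'rV[R]_N) (xb x1 : R -> 'rV[R]_N)
    (tau t0 eps : R) : R :=
  tau^-1 * \int[lebesgue_measure]_(t in `[t0, t0 + tau])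
             \tr (variational_matrix f0 f1 xb x1 t eps).

Definition lyapunov_stable (R : realType) (V : normedModType R) (D : set V)
    (F : R -> V -> V) (x : R -> V) : Prop :=
  forall s eta : R, 0 < eta -> exists2 rho, 0 < rho &
  forall y0, D y0 -> `|y0 - x s| < rho ->
  (exists y, solution D F `[s, +oo[ y /\ y s = y0) /\
  forall y, solution D F `[s, +oo[ y -> y s = y0 ->
  forall t, s <= t -> `|y t - x t| < eta.

Definition lyapunov_unstable (R : realType) (V : normedModType R) (D : set V)
    (F : R -> V -> V) (x : R -> V) : Prop :=
  ~ lyapunov_stable D F x.

(* Main.v *)
(* The mean divergence along the periodic orbit x_eps of the perturbed system is
   lambda_eps + o(eps), and lambda_eps is linear in eps: the unperturbed period
   map is conjugate to a shear in action-angle coordinates, so its derivative has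
   determinant 1 and, by Liouville's formula, the divergence of f0 has integral 0
   over the unperturbed orbit.  Hence for small eps the divergence of the
   perturbed field has positive integral over the period as soon as
   lambda_eps > 0.  By Liouville's formula again the derivative M of the period
   map at the fixed point has determinant > 1, hence a complex eigenvalue of
   modulus > 1, and orbits of the period map near the corresponding directions
   leave a fixed neighbourhood.

   No existence theorem for differential equations is needed: Lyapunov stability
   itself provides the solutions starting near x_eps, and M is the limit of their
   difference quotients. *)
Require Import Defs.
From HB Require Import structures.
From mathcomp Require Import all_boot all_order all_algebra.
From mathcomp Require Import perm spectral complex.
From mathcomp Require Import all_classical all_reals all_analysis.
From mathcomp Require Import ring lra.
Import Order.TTheory GRing.Theory Num.Theory.
Import numFieldNormedType.Exports.
Local Open Scope classical_set_scope.
Local Open Scope ring_scope.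
Set Implicit Arguments.
Unset Strict Implicit.
Unset Printing Implicit Defensive.

(** * Growth under expanding matrices *)

Import Normc.

(** Nearby orbits are real, whereas the expanding eigenvalue may be complex, and [M] may have other
    eigenvalues inside or on the unit circle as well as Jordan blocks. Instead of splitting the
    space into invariant subspaces, one builds a functional on complex vectors from a triangular
    form of [M]. Starting from a positive value, it grows at every step of a sequence that follows
    [M] up to an error small relative to the current norm, and such an error is exactly what
    differentiability at the fixed point provides. The real and imaginary parts of the starting
    vector are followed as two real orbits.

    A second obstacle is uniformity in time: the expansion of x_eps holds for each t with its own
    constants, and nothing is assumed on x_1 as a function of t. Uniform closeness to x_0 therefore
    comes from the expansion at one initial time and Gronwall's inequality; elsewhere the expansion
    serves pointwise in t, and dominated convergence carries it to the integral. *)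

Section complex_growth.
Variables (R : realType) (n : nat).
Implicit Types (w : 'rV[R[i]]_n.+1).

Lemma normc_ge0 (x : R[i]) : 0 <= normc x.
Proof. by case: x => a b; exact: sqrtr_ge0. Qed.

Lemma normc_sum (I : Type) (r : seq I) (P : pred I) (F : I -> R[i]) :
  normc (\sum_(i <- r | P i) F i) <= \sum_(i <- r | P i) normc (F i).
Proof.
elim/big_rec2 : _ => [|i y1 y2 _ h]; first by rewrite normc0.
by apply: (le_trans (le_normcD _ _)); rewrite lerD2l.
Qed.

Definition l1normc w : R := \sum_j normc (w 0 j).

Lemma l1normc_ge0 w : 0 <= l1normc w.
Proof. by apply: sumr_ge0 => j _; exact: normc_ge0. Qed.

Lemma normc_le_l1normc w j : normc (w 0 j) <= l1normc w.
Proof.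
rewrite /l1normc (bigD1 j)//= lerDl; apply: sumr_ge0 => k _; exact: normc_ge0.
Qed.

Lemma l1normc_mulmx (Q : 'M[R[i]]_n.+1) :
  exists2 c : R, 0 < c & forall w, l1normc (w *m Q) <= c * l1normc w.
Proof.
exists (1 + \sum_j \sum_i normc (Q i j)) => [|w].
  apply: (lt_le_trans ltr01); rewrite lerDl; apply: sumr_ge0 => i _.
  by apply: sumr_ge0 => j _; exact: normc_ge0.
rewrite mulrDl mul1r -[leLHS]add0r lerD ?l1normc_ge0// mulr_suml.
apply: ler_sum => j _; rewrite mulr_suml mxE.
apply: (le_trans (normc_sum _ _ _)); apply: ler_sum => i _.
by rewrite normcM mulrC ler_wpM2l ?normc_ge0 ?normc_le_l1normc.
Qed.

Lemma gap_above_one (I : finType) (f : I -> R) :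
  exists2 g : R, 0 < g & forall i, 1 < f i -> 1 + g <= f i.
Proof.
(* The default value 1 of the minimum covers the case where no [f i] exceeds 1. *)
exists (\big[Num.min/1]_(i | 1 < f i) (f i - 1)).
  by apply: lt_bigmin => // i hi; rewrite subr_gt0.
by move=> i hi; rewrite addrC -lerBrDr; exact: bigmin_le_cond.
Qed.

(* With weights K^j, K large, the strictly lower part of a triangular matrix
   becomes a small perturbation of its diagonal part; the functional weighing
   the expanding coordinates positively and the others negatively then grows
   geometrically on the cone where it is nonnegative. *)
Lemma trig_growth (T : 'M[R[i]]_n.+1) : is_trig_mx T -> 1 < normc (\det T) ->
  exists V : 'rV[R[i]]_n.+1 -> R, exists u kappa g,
  [/\ 0 < kappa /\ 0 < g,
      0 < V u,
      forall (h : R) w, 0 <= h -> V (h%:C%C *: w) = h * V w,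
      exists B, forall w, V w <= B * l1normc w &
      forall w w', 0 <= V w -> l1normc (w' - w *m T) <= kappa * l1normc w ->
        (1 + g) * V w <= V w'].
Proof.
move=> Ttrig detT.
have [j0 hj0] : exists j, 1 < normc (T j j).
  apply/not_existsP => h; move: detT; rewrite det_trig// ltNge => /negP; apply.
  elim/big_ind : _ => [|x y hx hy|i _].
  - by rewrite normc1.
  - by rewrite normcM mulr_ile1 ?normc_ge0.
  - by rewrite leNgt; apply/negP/h.
have [g g0 hg] := gap_above_one (fun j => normc (T j j)).
pose tt := \sum_i \sum_j normc (T i j).
have tt0 : 0 <= tt.
  by apply: sumr_ge0 => i _; apply: sumr_ge0 => j _; exact: normc_ge0.
(* Coordinate [j] of [w *m T] receives, besides the diagonal term, only [w 0 i] with [j < i].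
   Against the weights this costs K^j / K^i <= 1 / K, so this [K] keeps the total off-diagonal
   contribution below g / 8 of the weighted norm. *)
have [K K1 hK] : exists2 K : R, 1 <= K & tt <= K * (g / 8).
  exists (1 + tt * 8 / g); first by rewrite lerDl !mulr_ge0// invr_ge0 ltW.
  rewrite mulrDl mul1r mulrA divfK ?gt_eqF//.
  by rewrite mulfK// lerDr divr_ge0// ltW.
have K0 : 0 < K by exact: lt_le_trans K1.
pose U j := 1 < normc (T j j).
pose up w := \sum_(j | U j) K ^+ j * normc (w 0 j).
pose dn w := \sum_(j | ~~ U j) K ^+ j * normc (w 0 j).
pose nK w := \sum_(j < n.+1) K ^+ j * normc (w 0 j).
have nKE w : nK w = up w + dn w by rewrite /nK (bigID U).
have Kn0 (j : 'I_n.+1) w : 0 <= K ^+ j * normc (w 0 j).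
  by rewrite mulr_ge0 ?exprn_ge0 ?normc_ge0// ltW.
have dn0 w : 0 <= dn w by apply: sumr_ge0.
have up0 w : 0 <= up w by apply: sumr_ge0.
have l1nK w : l1normc w <= nK w.
  by apply: ler_sum => j _; rewrite ler_peMl ?normc_ge0// exprn_ege1.
have nKl1 w : nK w <= K ^+ n * l1normc w.
  rewrite mulr_sumr; apply: ler_sum => j _; rewrite ler_wpM2r ?normc_ge0//.
  by rewrite ler_weXn2l// -ltnS.
have Kn : 0 < K ^+ n by rewrite exprn_gt0.
exists (fun w => up w - dn w), (delta_mx 0 j0), (g / 8 / K ^+ n), (g / 2).
split.
- by rewrite !divr_gt0.
- rewrite subr_gt0 /up (bigD1 j0)//= !mxE !eqxx normc1 mulr1.
  rewrite /dn big1 ?ltr_wpDr ?exprn_gt0//; last first.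
    move=> j /negP hj; rewrite mxE /=.
    by case: eqP => [jj|_]; [rewrite jj in hj|rewrite normc0 mulr0].
  exact: sumr_ge0.
- move=> h w h0; have nh : normc (h%:C)%C = h.
    by rewrite /normc/= expr0n addr0 sqrtr_sqr ger0_norm.
  by rewrite mulrBr !mulr_sumr; congr (_ - _); apply: eq_bigr => j _;
    rewrite mxE normcM nh mulrCA.
- exists (K ^+ n) => w; apply: le_trans (nKl1 w); rewrite nKE.
  by have := dn0 w; lra.
move=> w w' Vw hw'.
have he : nK (w' - w *m T) <= g / 8 * nK w.
  apply: (le_trans (nKl1 _)); rewrite mulrC -ler_pdivlMr//.
  apply: (le_trans hw'); rewrite [leRHS]mulrAC ler_wpM2l ?l1nK//.
  by rewrite !divr_ge0// ltW.
pose off w (j : 'I_n.+1) := \sum_(i < n.+1 | (j < i)%N) normc (w 0 i) * normc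
    (T i j).
have hoff : \sum_(j < n.+1) K ^+ j * off w j <= g / 8 * nK w.
  apply: (@le_trans _ _ (\sum_(j < n.+1) \sum_(i < n.+1)
      K ^+ i * normc (w 0 i) * (K^-1 * normc (T i j)))).
    apply: ler_sum => j _; rewrite /off mulr_sumr big_mkcond; apply: ler_sum.
    move=> i _; case: ifPn => [ji|_]; last first.
      by rewrite !mulr_ge0 ?invr_ge0 ?normc_ge0 ?exprn_ge0// ltW.
    rewrite [leRHS]mulrACA ler_wpM2r ?mulr_ge0 ?normc_ge0//.
    rewrite ler_pdivlMr// -exprSr.
    by rewrite ler_weXn2l.
  rewrite exchange_big/= /nK mulr_sumr; apply: ler_sum => i _.
  rewrite -mulr_sumr mulrC ler_wpM2r// -mulr_sumr ler_pdivrMl//.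
  apply: le_trans hK; rewrite /tt [leRHS](bigD1 i)//= lerDl.
  by do 2!(apply: sumr_ge0 => ? _); exact: normc_ge0.
have wT (j : 'I_n.+1) : (w *m T) 0 j = w 0 j * T j j + \sum_(i < n.+1 | (j <
    i)%N) w 0 i * T i j.
  rewrite mxE (bigD1 j)//=; congr (_ + _).
  rewrite big_mkcond [RHS]big_mkcond; apply: eq_bigr => i _.
  case: (ltngtP j i) => [ji|ij|/val_inj ->]; last by rewrite eqxx.
  - by rewrite -val_eqE /= gtn_eqF.
  - by rewrite -val_eqE /= ltn_eqF// (is_trig_mxP Ttrig)// mulr0.
have dj (j : 'I_n.+1) : `|normc (w' 0 j) - normc (w 0 j) * normc (T j j)| <=
    off w j + normc ((w' - w *m T) 0 j).
  have offE : normc (\sum_(i < n.+1 | (j < i)%N) w 0 i * T i j) <= off w j.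
    apply: (le_trans (normc_sum _ _ _)); apply: ler_sum => i _.
    by rewrite normcM.
  set o := \sum_(i | _) _ in offE *.
  set e := (w' - w *m T) 0 j.
  have E1 : w' 0 j = (w 0 j * T j j + o) + e by rewrite -wT /e [X in _ = _ +
      X]mxE [X in _ + (_ + X)]mxE addrC subrK.
  have E2 : w 0 j * T j j = (w' 0 j - o) - e by rewrite E1; ring.
  rewrite -normcM ler_norml; apply/andP; split.
    have := le_normcD (w' 0 j - o) (- e); rewrite -E2 normcN.
    by have := le_normcD (w' 0 j) (- o); rewrite normcN; lra.
  have := le_normcD (w 0 j * T j j + o) e; rewrite -E1.
  by have := le_normcD (w 0 j * T j j) o; lra.
have upw' : (1 + g) * up w -
    \sum_(j < n.+1 | U j) K ^+ j * (off w j + normc ((w' - w *m T) 0 j)) <= up w'.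
  rewrite mulr_sumr -sumrB; apply: ler_sum => j Uj.
  rewrite mulrCA -mulrBr ler_wpM2l ?exprn_ge0 ?(ltW K0)//.
  have := dj j; rewrite ler_norml => /andP[+ _].
  have := ler_wpM2l (normc_ge0 (w 0 j)) (hg _ Uj); lra.
have dnw' : dn w' <= dn w +
    \sum_(j < n.+1 | ~~ U j) K ^+ j * (off w j + normc ((w' - w *m T) 0 j)).
  rewrite -big_split /=; apply: ler_sum => j Uj.
  rewrite -mulrDr ler_wpM2l ?exprn_ge0 ?(ltW K0)//.
  have := dj j; rewrite ler_norml => /andP[_].
  have Tj : normc (T j j) <= 1 by rewrite leNgt.
  have := ler_wpM2l (normc_ge0 (w 0 j)) Tj; lra.
have err : \sum_(j < n.+1 | U j) K ^+ j * (off w j + normc ((w' - w *m T) 0 j)) +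
  \sum_(j < n.+1 | ~~ U j) K ^+ j * (off w j + normc ((w' - w *m T) 0 j)) <=
  g / 4 * nK w.
  rewrite (_ : _ + _ = \sum_(j < n.+1)
    K ^+ j * (off w j + normc ((w' - w *m T) 0 j))); last first.
    by rewrite [RHS](bigID U).
  under eq_bigr do rewrite mulrDr.
  by rewrite big_split /=; move: he hoff; rewrite /nK; lra.
(* The only use of the cone condition: errors of size g / 4 times [nK w] become at most g / 2 times
   [up w], which leaves half of the expansion [g]. *)
have hn : nK w <= 2 * up w by rewrite nKE; lra.
have : g / 4 * nK w <= g / 4 * (2 * up w).
  by apply: ler_wpM2l hn; rewrite divr_ge0// ltW.
have : g / 2 * dn w >= 0 by rewrite mulr_ge0// divr_ge0// ltW.
lra.
Qed.

(** Schur's theorem gives a triangular matrix similar to [M], with the same determinant. The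
    functional is read in the new basis, and the bounds [c] and [d] on the change of basis and its
    inverse are paid for in [kappa]. *)
Lemma expanding_growth (M : 'M[R[i]]_n.+1) : 1 < normc (\det M) ->
  exists V : 'rV[R[i]]_n.+1 -> R, exists u kappa g,
  [/\ 0 < kappa /\ 0 < g,
      0 < V u,
      forall (h : R) w, 0 <= h -> V (h%:C%C *: w) = h * V w,
      exists B, forall w, V w <= B * l1normc w &
      forall w w', 0 <= V w -> l1normc (w' - w *m M) <= kappa * l1normc w ->
        (1 + g) * V w <= V w'].
Proof.
move=> detM; have [//|P Pu Ptrig] := @Schur _ n.+1 M.
have Punit : P \in unitmx by exact: unitarymx_unit.
set T := conjmx P M in Ptrig.
have TE : T = P *m M *m invmx P by rewrite /T conjumx.
have detT : \det T = \det M.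
  by rewrite TE !det_mulmx mulrAC -det_mulmx mulmxV// det1 mul1r.
have [|V [u [kappa [g [[k0 g0] Vu Vh [B VB] Vg]]]]] := trig_growth Ptrig.
  by rewrite detT.
have [c c0 hc] := l1normc_mulmx (invmx P).
have [d d0 hd] := l1normc_mulmx P.
exists (fun w => V (w *m invmx P)), (u *m P), (kappa / c / d), g; split.
- by rewrite !divr_gt0.
- by rewrite mulmxK.
- by move=> h w h0; rewrite -scalemxAl Vh.
- exists (`|B| * c) => w; apply: (le_trans (VB _)).
  rewrite -mulrA; apply: (@le_trans _ _ (`|B| * l1normc (w *m invmx P))).
    by rewrite ler_wpM2r ?l1normc_ge0 ?ler_norm.
  by rewrite ler_wpM2l.
move=> w w' Vw hw; apply: Vg => //.
have -> : w' *m invmx P - w *m invmx P *m T = (w' - w *m M) *m invmx P.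
  by rewrite TE mulmxBl !mulmxA mulmxKV.
apply: (le_trans (hc _)).
rewrite mulrC -ler_pdivlMr//; apply: (le_trans hw).
rewrite -!mulrA ler_wpM2l ?(ltW k0)//.
rewrite [leRHS]mulrC ler_wpM2l ?invr_ge0 ?(ltW c0)//.
by rewrite mulrC ler_pdivrMr// mulrC; have := hd (w *m invmx P); rewrite mulmxKV.
Qed.

End complex_growth.

Lemma normr_rV_coord (R : realType) n (v : 'rV[R]_n) j : `|v 0 j| <= `|v|.
Proof. by rewrite [leRHS]mx_normrE; exact: (le_bigmax _ _ (0, j)). Qed.

Lemma normr_rV_le (R : realType) n (v : 'rV[R]_n) e : 0 <= e ->
  (forall j, `|v 0 j| <= e) -> `|v| <= e.
Proof.
by move=> e0 h; rewrite [leLHS]mx_normrE bigmax_le// => -[i j] _; rewrite ord1.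
Qed.

Lemma normc_le_ReIm (R : realType) (a b : R) :
  normc (a +i* b)%C <= `|a| + `|b|.
Proof.
rewrite /normc -[leRHS]ger0_norm ?addr_ge0// -sqrtr_sqr ler_wsqrtr// sqrrD.
by rewrite !real_normK ?num_real// lerD2r lerDl mulrn_wge0// mulr_ge0.
Qed.

Lemma Re_le_normc (R : realType) (a b : R) : `|a| <= normc (a +i* b)%C.
Proof. by rewrite -sqrtr_sqr ler_wsqrtr// lerDl sqr_ge0. Qed.

Lemma Im_le_normc (R : realType) (a b : R) : `|b| <= normc (a +i* b)%C.
Proof. by rewrite -sqrtr_sqr ler_wsqrtr// lerDr sqr_ge0. Qed.

(* Two real sequences are the real and imaginary parts of a complex one, so
   that eigenvectors for non-real eigenvalues can be used. *)
Lemma expanding_pair (R : realType) n (M : 'M[R]_n.+1) : 1 < `|\det M| ->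
  exists2 kappa : R, 0 < kappa & exists a b : 'rV[R]_n.+1,
  forall h, 0 < h -> forall u v : nat -> 'rV[R]_n.+1,
  u 0%N = h *: a -> v 0%N = h *: b ->
  (forall k, `|u k.+1 - u k *m M| <= kappa * `|u k|) ->
  (forall k, `|v k.+1 - v k *m M| <= kappa * `|v k|) ->
  forall B, exists k, B < `|u k| + `|v k|.
Proof.
move=> detM; pose MC := map_mx (real_complex R) M.
have [|V [u [kappa [g [[k0 g0] Vu Vh [B VB] Vg]]]]] := @expanding_growth _ _ MC.
  rewrite det_map_mx /= /normc/= expr0n addr0 sqrtr_sqr; exact: detM.
pose N : R := n.+1%:R.
have N0 : 0 < N by rewrite ltr0n.
(* [N] is lost in passing from the sup norm to the sum of moduli, and 2 in adding the errors of the
   two sequences. *)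
exists (kappa / 2 / N); first by rewrite !divr_gt0.
exists (map_mx (@complex.Re R) u), (map_mx (@complex.Im R) u).
move=> h h0 a b a0 b0 ha hb C.
pose w k : 'rV[R[i]]_n.+1 := \row_j (a k 0 j +i* b k 0 j)%C.
have w0 : w 0%N = h%:C%C *: u.
  apply/rowP => j; rewrite !mxE a0 b0 !mxE; case: (u 0 j) => r s /=.
  by apply/eqP; rewrite eq_complex /= !mul0r subr0 addr0 !eqxx.
have wl1 k : l1normc (w k) <= N * (`|a k| + `|b k|).
  rewrite [leRHS]mulrC mulr_natr -[X in _ *+ X]card_ord -sumr_const.
  apply: ler_sum => j _; rewrite mxE (le_trans (normc_le_ReIm _ _))//.
  by rewrite lerD ?normr_rV_coord.
have al1 k : `|a k| <= l1normc (w k).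
  apply: normr_rV_le => [|j]; first exact: l1normc_ge0.
  by apply: le_trans (normc_le_l1normc _ j); rewrite mxE Re_le_normc.
have bl1 k : `|b k| <= l1normc (w k).
  apply: normr_rV_le => [|j]; first exact: l1normc_ge0.
  by apply: le_trans (normc_le_l1normc _ j); rewrite mxE Im_le_normc.
have wM k j : (w k.+1 - w k *m MC) 0 j =
    ((a k.+1 - a k *m M) 0 j +i* (b k.+1 - b k *m M) 0 j)%C.
  rewrite !mxE.
  have -> : \sum_l w k 0 l * MC l j =
     ((\sum_l a k 0 l * M l j) +i* (\sum_l b k 0 l * M l j))%C.
    transitivity (\sum_l ((a k 0 l * M l j) +i* (b k 0 l * M l j))%C).
      apply: eq_bigr => l _; rewrite !mxE.
      by apply/eqP; rewrite eq_complex /= !mulr0 subr0 add0r !eqxx.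
    by elim/big_rec3 : _ => [//|l x y z _ ->].
  by [].
have step k : l1normc (w k.+1 - w k *m MC) <= kappa * l1normc (w k).
  apply: (@le_trans _ _ (N * (`|a k.+1 - a k *m M| + `|b k.+1 - b k *m M|))).
    rewrite [leRHS]mulrC mulr_natr -[X in _ *+ X]card_ord -sumr_const.
    apply: ler_sum => j _; rewrite wM (le_trans (normc_le_ReIm _ _))//.
    by rewrite lerD ?normr_rV_coord.
  rewrite mulrC -ler_pdivlMr//.
  have ka : kappa / 2 / N * `|a k| <= kappa / 2 / N * l1normc (w k).
    by rewrite ler_wpM2l// !divr_ge0// ltW.
  have kb : kappa / 2 / N * `|b k| <= kappa / 2 / N * l1normc (w k).
    by rewrite ler_wpM2l// !divr_ge0// ltW.
  have -> : kappa * l1normc (w k) / N = 2 * (kappa / 2 / N * l1normc (w k)).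
    by field; rewrite gt_eqF.
  rewrite mulr_natl mulr2n lerD//; [exact: le_trans (ha k) ka|].
  exact: le_trans (hb k) kb.
have Vw0 : 0 < V (w 0%N) by rewrite w0 Vh ?(ltW h0)// mulr_gt0.
(* A Bernoulli-type bound, linear in [k], suffices for the Archimedean argument below. The second
   conjunct keeps the sequence in the cone where [Vg] applies. *)
have grow k : V (w 0%N) * (1 + k%:R * g) <= V (w k) /\ 0 <= V (w k).
  elim: k => [|k [ih1 ih2]]; first by rewrite mul0r addr0 mulr1 lexx ltW.
  have V1 := Vg _ _ ih2 (step k).
  have Vk : V (w 0%N) <= V (w k).
    by apply: le_trans ih1; rewrite ler_peMr ?(ltW Vw0)// lerDl mulr_ge0// ltW.
  have gV : g * V (w 0%N) <= g * V (w k) by rewrite ler_wpM2l// ltW.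
  have gV0 : 0 <= g * V (w 0%N) by rewrite mulr_ge0// ltW.
  by rewrite -[in k.+1%:R]addn1 natrD; split; lra.
have D0 : 0 < (`|B| + 1) * N by rewrite mulr_gt0// ltr_wpDl.
pose X : R := `|C| * ((`|B| + 1) * N) / (V (w 0%N) * g).
exists (Num.bound X).
have hX : X < (Num.bound X)%:R.
  apply: archi_boundP; rewrite /X divr_ge0 ?mulr_ge0 ?addr_ge0 ?(ltW N0)//;
      exact: ltW.
apply: (le_lt_trans (ler_norm C)).
move: hX; set k := Num.bound X; rewrite /X ltr_pdivrMr ?mulr_gt0// => hX.
have [grk _] := grow k.
rewrite -(ltr_pM2r D0); apply: (lt_le_trans hX).
apply: (@le_trans _ _ (V (w k))); first by move: grk; have := Vw0; lra.
apply: (le_trans (VB _)); apply: (@le_trans _ _ ((`|B| + 1) * l1normc (w k))).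
  by rewrite ler_wpM2r ?l1normc_ge0// (le_trans (ler_norm B))// lerDl.
by rewrite mulrCA (mulrC (_ + _) N) ler_wpM2l// addr_ge0.
Qed.

(** * Determinants *)


(* det (1 + X N) is a unit of R[X], with inverse det (1 - X N), hence constant. *)
Lemma det_add1_square0 (R : idomainType) n (N : 'M[R]_n) :
  N *m N = 0 -> \det (1%:M + N) = 1.
Proof.
move=> N2; pose NX := 'X *: map_mx polyC N.
have NX2 : NX *m NX = 0.
  by rewrite -scalemxAl -scalemxAr -map_mxM N2 map_mx0 !scaler0.
have u : \det (1%:M + NX) * \det (1%:M - NX) = 1.
  rewrite -det_mulmx mulmxDl mul1mx mulmxBr mulmx1 NX2 subr0 subrK.
  by rewrite det1.
have /size_poly1P[c c0 detE] : size (\det (1%:M + NX)) == 1%N.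
  by have /andP[] : \det (1%:M + NX) \is a GRing.unit
    by apply/unitrP; exists (\det (1%:M - NX)); rewrite mulrC u.
have evE (a : R) : (\det (1%:M + NX)).[a] = \det (1%:M + a *: N).
  rewrite -horner_evalE -det_map_mx; congr (\det _).
  apply/matrixP => i j; rewrite !mxE /= horner_evalE hornerD hornerM hornerX.
  by rewrite hornerC hornerMn hornerC.
transitivity c; first by rewrite -[N]scale1r -evE detE hornerC.
by have := evE 0; rewrite detE hornerC scale0r addr0 det1.
Qed.

Lemma is_derive_prod (R : realFieldType) n (f : 'I_n -> R -> R)
    (df : 'I_n -> R) (t : R) :
  (forall i, is_derive t 1 (f i) (df i)) ->
  is_derive t 1 (fun s => \prod_i f i s)
    (\sum_i \prod_j (if j == i then df j else f j t)).
Proof.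
elim: n f df => [|n ih] f df hf.
  rewrite big_ord0 (_ : (fun _ => _) = cst 1); first exact: is_derive_cst.
  by apply/funext => s; rewrite big_ord0.
rewrite (_ : (fun _ => _) =
  f ord0 * (fun s => \prod_i f (lift ord0 i) s)); last first.
  by apply/funext => s; rewrite big_ord_recl.
have := ih (fun i => f (lift ord0 i)) (fun i => df (lift ord0 i))
  (fun i => hf (lift ord0 i)).
move=> hp; have h0 := hf ord0.
apply: is_derive_eq.
rewrite big_ord_recl /= addrC; congr (_ + _).
  rewrite big_ord_recl/= /GRing.scale/= mulrC; congr (_ * _).
rewrite /GRing.scale/= mulr_sumr; apply: eq_bigr => i _.
by rewrite big_ord_recl/=; congr (_ * _).
Qed.

Lemma is_derive_bigsum (R : realFieldType) (I : Type) (r : seq I)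
    (c : I -> R) (f : I -> R -> R) (df : I -> R) (t : R) :
  (forall i, is_derive t 1 (f i) (df i)) ->
  is_derive t 1 (fun s => \sum_(i <- r) c i * f i s)
    (\sum_(i <- r) c i * df i).
Proof.
move=> hf; elim: r => [|i r ih].
  rewrite big_nil (_ : (fun _ => _) = cst 0); first exact: is_derive_cst.
  by apply/funext => s; rewrite big_nil.
rewrite big_cons (_ : (fun _ => _) =
  c i *: f i + (fun s => \sum_(i <- r) c i * f i s)); last first.
  by apply/funext => s; rewrite big_cons.
exact: is_deriveD.
Qed.

(** Jacobi's formula. The product rule in the Leibniz expansion yields, for each row [i], the
    determinant with that row replaced by its derivative; expansion along this row brings in the
    cofactors. *)
Lemma is_derive_det (R : realFieldType) n (W : R -> 'M[R]_n) (dW : 'M[R]_n)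
    (t : R) :
  (forall i j, is_derive t 1 (fun s => W s i j) (dW i j)) ->
  is_derive t 1 (fun s => \det (W s)) (\tr (dW *m \adj (W t))).
Proof.
move=> hW.
have hs (s : {perm 'I_n}) : is_derive t 1 (fun r => \prod_i W r i (s i))
   (\sum_i \prod_j (if j == i then dW j (s j) else W t j (s j))).
  by apply: (is_derive_prod (f := fun i r => W r i (s i))).
have main := is_derive_bigsum (index_enum {perm 'I_n}) (fun s => (-1) ^+ s) hs.
apply: is_derive_eq main _.
under eq_bigr do rewrite mulr_sumr.
rewrite exchange_big /= /mxtrace; apply: eq_bigr => i _; rewrite mxE.
pose Wi := \matrix_(j, k) (if j == i then dW j k else W t j k).
transitivity (\det Wi).
  by apply: eq_bigr => s _; congr (_ * _); apply: eq_bigr => j _; rewrite mxE.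
rewrite (expand_det_row _ i); apply: eq_bigr => j _.
rewrite !mxE eqxx; congr (_ * _); rewrite /cofactor; congr (_ * \det _).
by apply/matrixP => k l; rewrite !mxE eq_sym (negbTE (neq_lift _ _)).
Qed.

(** * Gronwall estimates *)


Lemma ler_sum_const (R : realType) n (f : 'I_n -> R) (c : R) :
  (forall j, f j <= c) -> \sum_j f j <= n%:R * c.
Proof.
move=> h; apply: (@le_trans _ _ (\sum_(j < n) c)); first exact: ler_sum.
by rewrite sumr_const card_ord mulr_natl.
Qed.

Lemma is_derive_coord (R : realType) m n (W : R -> 'M[R]_(m, n)) (dW :
    'M[R]_(m, n))
    (t : R) i j :
  is_derive t 1 W dW -> is_derive t 1 (fun s => W s i j) (dW i j).
Proof.
move=> [dW1 dW2]; have h := (derivable_mxP W t 1).1 dW1 i j.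
by split=> //; rewrite -dW2 derive_mx// mxE.
Qed.

Lemma is_derive_continuous (R : realType) (V : normedModType R) (v : R -> V) (t
    : R) dv :
  is_derive t 1 v dv -> {for t, continuous v}.
Proof. by move=> [d _]; exact/differentiable_continuous/derivable1_diffP. Qed.

Lemma continuous_within_itv (R : realType) (V : normedModType R) (v : R -> V)
    (a b : R) :
  (forall t, t \in `[a, b] -> {for t, continuous v}) ->
  {within `[a, b], continuous v}.
Proof.
move=> h; apply: continuous_in_subspaceT => t.
by rewrite inE /= => /h.
Qed.

(** The function u(t) exp(-K (t - a)) - c (t - a) does not increase from [a] to [b]: its derivative
    is at most c (exp(-K (t - a)) - 1) <= 0. *)
Lemma scalar_gronwall (R : realType) (u du : R -> R) (K c a b : R) :
  a <= b -> 0 <= K -> 0 <= c ->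
  {within `[a, b], continuous u} ->
  (forall t, t \in `]a, b[ -> is_derive t 1 u (du t)) ->
  (forall t, t \in `]a, b[ -> du t <= K * u t + c) ->
  u b <= expR (K * (b - a)) * (u a + c * (b - a)).
Proof.
move=> ab K0 c0 cu hu du_le.
pose g t := u t * expR (- K * (t - a)) - c * (t - a).
have dg t : t \in `]a, b[ -> is_derive t 1 g
    (u t *: (expR (- K * (t - a)) * (- K)) + expR (- K * (t - a)) *: du t - c).
  move=> tab; have dut := hu t tab.
  have d1 : is_derive t 1 (fun s : R => - K * (s - a)) (- K).
    rewrite (_ : (fun _ => _) = (- K) *: (id - cst a)); last exact/funext.
    by apply: is_derive_eq; rewrite subr0 /GRing.scale/= mulr1.
  have d2 : is_derive t 1 (fun s => expR (- K * (s - a))) (expR (- K * (t - a))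
      * (- K)).
    by apply: (is_derive1_comp (f := expR) (g := fun s : R => - K * (s - a))).
  have d3 : is_derive t 1 (fun s : R => c * (s - a)) c.
    rewrite (_ : (fun _ => _) = c *: (id - cst a)); last exact/funext.
    by apply: is_derive_eq; rewrite subr0 /GRing.scale/= mulr1.
  rewrite /g (_ : (fun _ => _) = u * (fun s => expR (- K * (s - a))) -
    (fun s : R => c * (s - a))); last exact/funext.
  by apply: is_derive_eq.
have cg : {within `[a, b], continuous g}.
  have c1 (k : R) : continuous (fun s : R => k * (s - a)).
    move=> s; apply: cvgM; first exact: cvg_cst.
    by apply: cvgB; [exact: cvg_id|exact: cvg_cst].
  have c2 : continuous (fun s : R => expR (- K * (s - a))).
    move=> s; apply: continuous_comp; first exact: c1.
    exact: continuous_expR.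
  have cc1 : {within `[a, b], continuous (fun s : R => c * (s - a))}.
    exact: continuous_subspaceT.
  have cc2 : {within `[a, b], continuous (fun s : R => expR (- K * (s - a)))}.
    exact: continuous_subspaceT.
  by move=> t; apply: cvgB (cc1 t); apply: cvgM (cu t) (cc2 t).
have gab : g b <= g a.
  move: ab; rewrite le_eqVlt => /orP[/eqP <-//|ab].
  have [t tab] := MVT ab dg cg.
  have e1 : expR (- K * (t - a)) <= 1.
    rewrite -expR0 ler_expR mulNr oppr_le0 mulr_ge0// subr_ge0.
    by move: tab; rewrite in_itv/= => /andP[/ltW].
  move=> gE; rewrite -subr_le0 gE pmulr_lle0 ?subr_gt0// /GRing.scale/=.
  have e0 := expR_gt0 (- K * (t - a)).
  have := ler_wpM2l (ltW e0) (du_le t tab); have := ler_wpM2l c0 e1.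
  by rewrite mulr1; nra.
move: gab; rewrite /g !subrr !mulr0 subr0 expR0 mulr1 mulNr expRN => h.
have e0 := expR_gt0 (K * (b - a)).
by rewrite mulrC -ler_pdivrMr//; lra.
Qed.

(** This bounds the growth of the squared norm, and being at least 1 it also bounds its square root.
    The factor 2 L + 1 comes from 2 |v| (L |v| + c) <= (2 L + 1) |v|^2 + c^2, and the dimension from
    comparing the sup norm with the sum of squares. *)
Definition gronwall_constant (R : realType) (n : nat) (L l : R) : R :=
  expR ((2 * L + 1) * n.+1%:R * l) * n.+1%:R * (1 + l).

Lemma gronwall_constant_ge1 (R : realType) n (L l : R) : 0 <= L -> 0 <= l ->
  1 <= gronwall_constant n L l.
Proof.
move=> L0 l0; rewrite /gronwall_constant.
rewrite mulr_ege1//; last by rewrite lerDl.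
rewrite mulr_ege1 ?ler1n// -expR0 ler_expR !mulr_ge0// addr_ge0// mulr_ge0//.
Qed.

Lemma le_gronwall_constant (R : realType) n (L l l' : R) : 0 <= L -> 0 <= l ->
  l <= l' -> gronwall_constant n L l <= gronwall_constant n L l'.
Proof.
move=> L0 l0 ll'; rewrite /gronwall_constant.
rewrite ler_pM// ?mulr_ge0 ?expR_ge0 ?addr_ge0 ?lerD2l//.
by rewrite ler_wpM2r// ler_expR ler_wpM2l// mulr_ge0// addr_ge0// mulr_ge0.
Qed.

Section gronwall.
Variables (R : realType) (n : nat).
Implicit Types v dv : R -> 'rV[R]_n.+1.

(* The sup norm is not differentiable: the estimate goes through the sum of the
   squares of the coordinates. *)
Lemma gronwall v dv (L c a b : R) :
  a <= b -> 0 <= L -> 0 <= c ->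
  (forall t, t \in `[a, b] -> is_derive t 1 v (dv t)) ->
  (forall t, t \in `]a, b[ -> `|dv t| <= L * `|v t| + c) ->
  `|v b| <= gronwall_constant n L (b - a) * (`|v a| + c).
Proof.
move=> ab L0 c0 hv dv_le; pose N : R := n.+1%:R.
have N0 : 0 <= N by [].
pose u t := \sum_j v t 0 j ^+ 2.
have dvj t j : t \in `[a, b] -> is_derive t 1 (fun s => v s 0 j) (dv t 0 j).
  by move=> tab; apply: is_derive_coord; exact: hv.
have du t : t \in `[a, b] -> is_derive t 1 u (\sum_j 1 * (2 * v t 0 j * dv t 0
    j)).
  move=> tab; rewrite /u.
  rewrite (_ : (fun _ => _) = (fun s => \sum_j 1 * (v s 0 j ^+ 2))); last first.
    by apply/funext => s; apply: eq_bigr => j _; rewrite mul1r.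
  apply: (is_derive_bigsum (index_enum 'I_n.+1) (fun=> 1)
    (f := fun (j : 'I_n.+1) s => v s 0 j ^+ 2)) => j.
  have dj := dvj t j tab.
  rewrite (_ : (fun _ => _) = (fun s => v s 0 j) ^+ 2); last exact/funext.
  by apply: is_derive_eq; rewrite /GRing.scale/= expr1 mulr_natl.
have ule t : u t <= N * `|v t| ^+ 2.
  apply: ler_sum_const => j; rewrite -real_normK ?num_real// lerXn2r ?nnegrE//.
  exact: normr_rV_coord.
have leu t : `|v t| ^+ 2 <= u t.
  have u0 : 0 <= u t by apply: sumr_ge0 => j _; exact: sqr_ge0.
  rewrite -[leRHS]sqr_sqrtr// lerXn2r ?nnegrE ?sqrtr_ge0//.
  apply: normr_rV_le => [|j]; first exact: sqrtr_ge0.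
  rewrite -sqrtr_sqr ler_wsqrtr// /u (bigD1 j)//= lerDl.
  by apply: sumr_ge0 => k _; exact: sqr_ge0.
have K0 : 0 <= (2 * L + 1) * N by rewrite mulr_ge0// addr_ge0// mulr_ge0.
have cu : {within `[a, b], continuous u}.
  apply: continuous_within_itv => t tab.
  exact: (is_derive_continuous (du t tab)).
have du' t : t \in `]a, b[ ->
    is_derive t 1 u (\sum_j 1 * (2 * v t 0 j * dv t 0 j)).
  by move=> tab; apply: du; exact: subset_itv_oo_cc.
have du_le t : t \in `]a, b[ -> \sum_j 1 * (2 * v t 0 j * dv t 0 j) <=
    (2 * L + 1) * N * u t + N * c ^+ 2.
  move=> tab.
  apply: (@le_trans _ _ (N * (2 * (`|v t| * (L * `|v t| + c))))).
    apply: ler_sum_const => j; rewrite mul1r -mulrA ler_wpM2l//.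
    rewrite (le_trans (ler_norm _))// normrM ler_pM ?normr_rV_coord//.
    exact: le_trans (normr_rV_coord _ _) (dv_le t tab).
  rewrite [leRHS](_ : _ = N * ((2 * L + 1) * u t + c ^+ 2)); last by ring.
  apply: ler_wpM2l => //.
  have := ler_wpM2l L0 (leu t); have := leu t; have := sqr_ge0 (`|v t| - c).
  nra.
have Nc0 : 0 <= N * c ^+ 2 by rewrite mulr_ge0 ?sqr_ge0.
have ub := scalar_gronwall ab K0 Nc0 cu du' du_le.
have C1 := @gronwall_constant_ge1 R n L (b - a) L0.
rewrite subr_ge0 in C1; have {}C1 := C1 ab.
set C := gronwall_constant n L (b - a) in C1 *.
have S0 : 0 <= `|v a| + c by rewrite addr_ge0.
rewrite -(@ler_pXn2r _ 2)// ?nnegrE ?mulr_ge0 ?(le_trans _ C1)//.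
rewrite exprMn; apply: (le_trans (leu b)); apply: (le_trans ub).
apply: (@le_trans _ _ (C * (`|v a| + c) ^+ 2)); last first.
  by rewrite ler_wpM2r ?sqr_ge0// expr2 ler_peMr// (le_trans _ C1).
rewrite /C /gronwall_constant -!mulrA ler_wpM2l ?expR_ge0//.
have ba : 0 <= b - a by rewrite subr_ge0.
have := ule a; have v0 := normr_ge0 (v a).
have c2 := sqr_ge0 c.
move=> ua; apply: (@le_trans _ _ (N * (`|v a| ^+ 2 + c ^+ 2 * (b - a)))).
  by rewrite mulrDr; nra.
rewrite ler_wpM2l//.
have : 0 <= (b - a) * (`|v a| ^+ 2 + 2 * `|v a| * c).
  by rewrite mulr_ge0// addr_ge0 ?sqr_ge0// !mulr_ge0.
have : 0 <= `|v a| * c by rewrite mulr_ge0.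
  nra.
by rewrite addr_ge0 ?subr_ge0.
Qed.

(** A continuity argument, the differential inequality being known only while [v] stays in the ball
    of radius [r]. Let [t1] be the infimum of the times at which [v] is outside. Gronwall's estimate
    holds up to [t1] and puts [v t1] strictly inside; by continuity [v] stays inside near [t1],
    which contradicts the choice of [t1]. *)
Lemma gronwall_bootstrap v dv (L c r a b : R) :
  a <= b -> 0 <= L -> 0 <= c ->
  (forall t, t \in `[a, b] -> is_derive t 1 v (dv t)) ->
  (forall t, t \in `[a, b] -> `|v t| <= r -> `|dv t| <= L * `|v t| + c) ->
  gronwall_constant n L (b - a) * (`|v a| + c) < r ->
  forall t, t \in `[a, b] ->
    `|v t| <= gronwall_constant n L (b - a) * (`|v a| + c).
Proof.
move=> ab L0 c0 hv dv_le Cr.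
have partial t : t \in `[a, b] -> (forall s, s \in `]a, t[ -> `|v s| <= r) ->
    `|v t| <= gronwall_constant n L (b - a) * (`|v a| + c).
  rewrite in_itv/= => /andP[a_t tb] hr.
  apply: (@le_trans _ _ (gronwall_constant n L (t - a) * (`|v a| + c))).
    apply: (gronwall a_t L0 c0) => s.
      rewrite in_itv/= => /andP[sa st]; apply: hv.
      by rewrite in_itv/= sa (le_trans st).
    move=> sat; apply: dv_le (hr _ sat); move: sat; rewrite !in_itv/=.
    by move=> /andP[sa st]; rewrite !ltW// (lt_le_trans st).
  rewrite ler_wpM2r ?addr_ge0// le_gronwall_constant ?subr_ge0//.
  by rewrite lerD2r.
pose S := [set t | t \in `[a, b] /\ r < `|v t|].
suff S0 : forall t, ~ S t.
  move=> t tab; apply: partial => // s; rewrite in_itv/= => /andP[sa st].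
  rewrite leNgt; apply/negP => rs; apply: (S0 s); split=> //.
  move: tab; rewrite !in_itv/= => /andP[_ tb].
  by rewrite (ltW sa) (le_trans (ltW st)).
move=> t0 St0; pose t1 := inf S.
have Sinf : has_inf S.
  by split; [exists t0|exists a => t [+ _]; rewrite in_itv/= => /andP[]].
have t1ab : t1 \in `[a, b].
  rewrite in_itv/=; apply/andP; split.
    by apply: lb_le_inf => [|t [+ _]]; [exists t0|rewrite in_itv/= => /andP[]].
  apply: (@le_trans _ _ t0); first by apply: ge_inf => //; case: Sinf.
  by case: St0; rewrite in_itv/= => /andP[].
have vt1 : `|v t1| < r.
  apply: le_lt_trans Cr; apply: partial => // s sat.
  rewrite leNgt; apply/negP => rs.
  suff : t1 <= s by rewrite leNgt => /negP; apply; move: sat; rewrite in_itv =>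
      /andP[].
  apply: ge_inf; first by case: Sinf.
  split=> //; move: sat t1ab; rewrite !in_itv/= => /andP[sa st] /andP[_ tb].
  by rewrite (ltW sa) (le_trans (ltW st)).
have : \forall t \near t1, `|v t| < r.
  have cv := is_derive_continuous (hv _ t1ab).
  have cn : {for t1, continuous (fun t => `|v t|)} by apply: cvg_norm.
  by move/cvgr_lt : cn => /(_ _ vt1).
move=> /nbhs_ballP[e /= e0 he].
have [s Ss st1] := inf_adherent e0 Sinf.
have t1s : t1 <= s by apply: ge_inf => //; case: Sinf.
have /he : ball t1 e s.
  by rewrite /ball/= distrC ger0_norm ?subr_ge0// ltrBlDl.
by case: Ss => _ /lt_trans h /h; rewrite ltxx.
Qed.

End gronwall.

(** * Solutions near a given solution *)


(** Continuity of the space derivatives is joint in time and space, so that compactness of a time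
    interval turns it into uniform bounds along a curve. *)
Definition C1_field (R : realType) (n : nat) (D : set 'rV[R]_n.+1)
    (F : R -> 'rV[R]_n.+1 -> 'rV[R]_n.+1) : Prop :=
  forall t y, D y -> differentiable (F t) y /\
    forall v, {for (t, y), continuous (fun p => 'D_v (F p.1) p.2)}.

Lemma cvg_comp_pair (T : Type) (U V W : topologicalType) (G : set_system T)
    (FG : Filter G) (f : T -> U) (g : T -> V) (h : U * V -> W) (u : U) (v : V) :
  f @ G --> u -> g @ G --> v -> {for (u, v), continuous h} ->
  (fun s => h (f s, g s)) @ G --> h (u, v).
Proof.
move=> fu gv hc.
exact: (cvg_comp (fun s => (f s, g s)) h (cvg_pair fu gv) hc).
Qed.

Lemma is_derive_line (R : realType) (V W : normedModType R) (f : V -> W)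
    (x v : V) (s : R) :
  differentiable f (x + s *: v) ->
  is_derive s 1 (fun r => f (x + r *: v)) ('d f (x + s *: v) v).
Proof.
move=> df.
have dl : is_diff s (fun r : R => x + r *: v) (fun r => r *: v).
  rewrite (_ : (fun _ => _) = cst x + (fun r : R => r *: v)); last exact/funext.
  by apply: is_diff_eq; rewrite add0r.
have dfl := differentiableP df.
have dc : is_diff s (f \o (fun r : R => x + r *: v))
   ('d f (x + s *: v) \o (fun r => r *: v)) by exact: is_diff_comp.
have d : differentiable (f \o (fun r : R => x + r *: v)) s by [].
split; first exact/derivable1_diffP.
by rewrite deriveE// diff_val/= scale1r.
Qed.

Section tube.
Variables (R : realType) (n : nat) (D : set 'rV[R]_n.+1).
Variable F : R -> 'rV[R]_n.+1 -> 'rV[R]_n.+1.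
Hypotheses (oD : open D) (C1F : C1_field D F).
Variables (x : R -> 'rV[R]_n.+1) (a b : R).
Hypothesis ab : a <= b.
Hypothesis Dx : forall t, t \in `[a, b] -> D (x t).
Hypothesis cx : forall t, t \in `[a, b] -> {for t, continuous x}.

Let e (j : 'I_n.+1) : 'rV[R]_n.+1 := delta_mx 0 j.

Lemma diff_rV_sum (f : 'rV[R]_n.+1 -> 'rV[R]_n.+1) y v : differentiable f y ->
  'd f y v = \sum_j v 0 j *: 'D_(e j) f y.
Proof.
move=> df; rewrite {1}(row_sum_delta v) linear_sum; apply: eq_bigr => j _.
by rewrite linearZ deriveE.
Qed.

Lemma diff_bounded : exists2 L, 0 <= L & forall (t : R) (v : 'rV[R]_n.+1), t
    \in `[a, b] ->
  `|'d (F t) (x t) v| <= L * `|v|.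
Proof.
have h (j : 'I_n.+1) : exists M, forall t, t \in `[a, b] ->
    `|'D_(e j) (F t) (x t)| <= M.
  have [|c _ hc] := @EVT_max _ (fun t => `|'D_(e j) (F t) (x t)|) a b ab.
    apply: continuous_within_itv => t tab; apply: cvg_norm.
    have [_ /(_ (e j)) h] := C1F t (Dx tab).
    by apply: (cvg_comp_pair _ cvg_id (cx tab) h).
  by exists `|'D_(e j) (F c) (x c)|.
have [M hM] := choice h.
exists (\sum_j `|M j|) => [|t v tab]; first by apply: sumr_ge0.
have [df _] := C1F t (Dx tab).
rewrite (diff_rV_sum v df) mulr_suml (le_trans (ler_norm_sum _ _ _))//.
apply: ler_sum => j _; rewrite normrZ mulrC ler_pM ?normr_rV_coord//.
exact: le_trans (hM j t tab) (ler_norm _).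
Qed.

(** Each time has a neighbourhood and a radius of displacements that work, by joint continuity at
    (t, 0); compactness of the segment, in its covering form, makes the radius common. *)
Lemma tube_partial eta : 0 < eta -> exists2 r, 0 < r & forall (t : R) (v :
    'rV[R]_n.+1), t \in `[a, b] ->
  `|v| < r -> D (x t + v) /\
  forall j, `|'D_(e j) (F t) (x t + v) - 'D_(e j) (F t) (x t)| < eta.
Proof.
move=> eta0.
have /compact_near_coveringP cK := @segment_compact R a b.
pose Q (v : 'rV[R]_n.+1) t := D (x t + v) /\
  forall j, `|'D_(e j) (F t) (x t + v) - 'D_(e j) (F t) (x t)| < eta.
suff : nbhs (0 : 'rV[R]_n.+1) (fun v => `[a, b] `<=` Q v).
  move=> /nbhs_ballP[r /= r0 hr]; exists r => // t v tab vr.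
  by apply: (hr v) => //; rewrite -ball_normE /ball_/= sub0r normrN.
suff H (t : R) : t \in `[a, b] ->
    nbhs (t, 0 : 'rV[R]_n.+1) (fun p : R * 'rV[R]_n.+1 => Q p.2 p.1).
  by apply: (cK 'rV[R]_n.+1 (nbhs (0 : 'rV[R]_n.+1)) Q).
move=> tab.
have c1 : (fun p : R * 'rV[R]_n.+1 => x p.1 + p.2) @ (t, 0 : 'rV[R]_n.+1) --> x t.
  rewrite -[X in _ --> X]addr0; apply: cvgD; last exact: cvg_snd.
  by apply: cvg_comp; [exact: cvg_fst|exact: cx].
have c0 : (fun p : R * 'rV[R]_n.+1 => x p.1) @ (t, 0 : 'rV[R]_n.+1) --> x t.
  by apply: cvg_comp; [exact: cvg_fst|exact: cx].
have n1 : nbhs (t, 0 : 'rV[R]_n.+1) (fun p : R * 'rV[R]_n.+1 => D (x p.1 + p.2)).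
  by apply: c1; exact: open_nbhs_nbhs (conj oD (Dx tab)).
have FF : Filter (nbhs (t, 0 : 'rV[R]_n.+1)) by exact: nbhs_filter.
suff n2 (j : 'I_n.+1) : nbhs (t, 0 : 'rV[R]_n.+1) (fun p : R * 'rV[R]_n.+1 =>
    `|'D_(e j) (F p.1) (x p.1 + p.2) - 'D_(e j) (F p.1) (x p.1)| < eta).
  by apply: (filterS2 FF _ n1 (filter_forall FF n2)) => p.
have [_ /(_ (e j)) h] := C1F t (Dx tab).
have h1 : (fun p : R * 'rV[R]_n.+1 => 'D_(e j) (F p.1) (x p.1 + p.2)) @ (t, 0 :
    'rV[R]_n.+1)
    --> 'D_(e j) (F t) (x t).
  by apply: (cvg_comp_pair _ cvg_fst c1 h).
have h0 : (fun p : R * 'rV[R]_n.+1 => 'D_(e j) (F p.1) (x p.1)) @ (t, 0 :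
    'rV[R]_n.+1)
    --> 'D_(e j) (F t) (x t).
  by apply: (cvg_comp_pair _ cvg_fst c0 h).
have := @cvgB _ _ _ _ FF _ _ _ _ h1 h0; rewrite subrr => h10.
exact: (@cvgr0_norm_lt _ _ _ _ FF _ h10 _ eta0).
Qed.

(** The mean value theorem on the segment from [x t] to [x t + v], one coordinate at a time, applied
    to [F t] minus its linear part. The [n.+1] partial derivatives each get an equal share of
    [eta]. *)
Lemma tube_linear eta : 0 < eta -> exists2 r, 0 < r & forall (t : R) (v :
    'rV[R]_n.+1), t \in `[a, b] ->
  `|v| < r -> D (x t + v) /\
  `|F t (x t + v) - F t (x t) - 'd (F t) (x t) v| <= eta * `|v|.
Proof.
move=> eta0; have eta1 : 0 < eta / n.+1%:R by rewrite divr_gt0.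
have [r r0 hr] := tube_partial eta1; exists r => // t v tab vr.
split; first by case: (hr t v tab vr).
apply: normr_rV_le => [|i]; first by rewrite mulr_ge0// ltW.
have seg (s : R) : s \in `[0, 1] -> `|s *: v| < r.
  rewrite in_itv/= => /andP[s0 s1]; apply: le_lt_trans vr.
  by rewrite normrZ ger0_norm// ler_piMl.
pose f (s : R) := (F t (x t + s *: v)) 0 i - s * ('d (F t) (x t) v) 0 i.
pose df (s : R) := ('d (F t) (x t + s *: v) v) 0 i - ('d (F t) (x t) v) 0 i.
have dfP (s : R) : s \in `[0, 1] -> is_derive s 1 f (df s).
  move=> s01; have [Ds _] := hr t _ tab (seg s s01).
  have [dF _] := C1F t Ds.
  have d1 := is_derive_coord 0 i (is_derive_line dF).
  have d2 : is_derive s 1 (fun s : R => s * ('d (F t) (x t) v) 0 i) (('d (F t)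
      (x t) v) 0 i).
    rewrite (_ : (fun _ => _) = (('d (F t) (x t) v) 0 i) *: id); last first.
      by apply/funext => q; rewrite /= mulrC.
    by apply: is_derive_eq; rewrite /GRing.scale/= mulr1.
  exact: (@is_deriveB R R R (fun r => F t (x t + r *: v) 0 i)
    (fun r => r * ('d (F t) (x t) v) 0 i) _ _ _ _ d1 d2).
have cf : {within `[0, 1], continuous f}.
  apply: continuous_within_itv => s s01.
  exact: (is_derive_continuous (dfP s s01)).
have dfo (s : R) : s \in `]0, 1[ -> is_derive s 1 f (df s).
  by move=> s01; apply: dfP; exact: subset_itv_oo_cc.
have l01 : (0 : R) <= 1 by exact: ler01.
have [s s01] := MVT_segment l01 dfo cf.
rewrite subr0 mulr1 /f scale1r scale0r addr0 mul1r mul0r subr0 => E.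
rewrite !mxE addrAC E.
have [Ds hs] := hr t _ tab (seg s s01).
have [dF _] := C1F t Ds; have [dF0 _] := C1F t (Dx tab).
pose coord (M : 'rV[R]_n.+1) := M 0 i.
have dfE : df s =
    coord (\sum_j v 0 j *: 'D_(e j) (F t) (x t + s *: v)) -
    coord (\sum_j v 0 j *: 'D_(e j) (F t) (x t)).
  by rewrite -(diff_rV_sum v dF) -(diff_rV_sum v dF0).
rewrite dfE /coord !summxE -sumrB (le_trans (ler_norm_sum _ _ _))//.
have -> : eta * `|v| = n.+1%:R * (eta / n.+1%:R * `|v|).
  by rewrite mulrA mulrCA divff ?pnatr_eq0// mulr1.
apply: ler_sum_const => j; rewrite !mxE -mulrBr normrM mulrC.
rewrite ler_pM ?normr_rV_coord//.
by apply: le_trans (ltW (hs j)); have := normr_rV_coord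
  ('D_(e j) (F t) (x t + s *: v) - 'D_(e j) (F t) (x t)) i; rewrite !mxE.
Qed.

End tube.

Section nearby_solutions.
Variables (R : realType) (n : nat) (D : set 'rV[R]_n.+1).
Variable F : R -> 'rV[R]_n.+1 -> 'rV[R]_n.+1.
Hypotheses (oD : open D) (C1F : C1_field D F).
Variables (x : R -> 'rV[R]_n.+1) (a b : R).
Hypothesis ab : a <= b.
Hypothesis solx : solution D F `[a, b] x.

(** The bootstrapped Gronwall estimate for [y - x] inside a tube. [C] is fixed before [eta], so that
    constants built from it can be chosen before the accuracy of the linearization. For [y a = x a]
    the first bound is uniqueness. *)
Lemma nearby_solution_linear : exists2 C, 0 < C & forall eta, 0 < eta ->
  exists2 rho, 0 < rho & forall y,
  (forall t, t \in `[a, b] -> is_derive t 1 y (F t (y t))) ->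
  `|y a - x a| < rho -> forall t, t \in `[a, b] ->
  `|y t - x t| <= C * `|y a - x a| /\
  `|F t (y t) - F t (x t) - 'd (F t) (x t) (y t - x t)| <= eta * `|y a - x a|.
Proof.
have Dx t : t \in `[a, b] -> D (x t) by move=> /solx[].
have dx t : t \in `[a, b] -> is_derive t 1 x (F t (x t)) by move=> /solx[].
have cx t : t \in `[a, b] -> {for t, continuous x}.
  by move=> /dx; exact: is_derive_continuous.
have [L L0 hL] := diff_bounded C1F ab Dx cx.
pose C := gronwall_constant n (L + 1) (b - a).
have C1 : 1 <= C.
  by apply: gronwall_constant_ge1; rewrite ?subr_ge0 ?addr_ge0.
have C0 : 0 < C by exact: lt_le_trans ltr01 C1.
exists C => // eta eta0.
(* The bound 1 gives the rate L + 1 in Gronwall's estimate; eta / C absorbs the factor [C] in the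
   final remainder. *)
have e0 : 0 < Num.min (eta / C) 1 by rewrite lt_min divr_gt0//=.
have [r r0 hr] := tube_linear oD C1F Dx cx e0.
exists (r / 2 / C) => [|y hy yx]; first by rewrite !divr_gt0.
have bnd t : t \in `[a, b] -> `|y t - x t| <= C * `|y a - x a|.
  move=> tab; have := @gronwall_bootstrap _ n (fun t => y t - x t)
    (fun t => F t (y t) - F t (x t)) (L + 1) 0 (r / 2) a b ab.
  rewrite addr0; apply => //.
  - by rewrite addr_ge0.
  - move=> s sab; have := hy s sab; have := dx s sab => h1 h2.
    by rewrite (_ : (fun _ => _) = y - x); [exact: is_deriveB|exact/funext].
  - move=> s sab hs; rewrite addr0 mulrDl mul1r.
    have sr : `|y s - x s| < r by apply: (le_lt_trans hs); rewrite
        ltr_pdivrMr// ltr_pMr// ltr1n.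
    have [_] := hr s _ sab sr; rewrite [x s + _]addrC subrK => h.
    have h' : `|F s (y s) - F s (x s) - 'd (F s) (x s) (y s - x s)| <= `|y s -
        x s|.
      by apply: (le_trans h); rewrite ler_piMl// ge_min lexx orbT.
    rewrite -[X in `|X|](subrK ('d (F s) (x s) (y s - x s))).
    by rewrite (le_trans (ler_normD _ _))// addrC lerD// hL.
  - by rewrite mulrC -ltr_pdivlMr.
move=> t tab; split; first exact: bnd.
have tr : `|y t - x t| < r.
  apply: (le_lt_trans (bnd t tab)); rewrite mulrC -ltr_pdivlMr//.
  by apply: (lt_trans yx); rewrite ltr_pM2r ?invr_gt0// ltr_pdivrMr// ltr_pMr//
      ltr1n.
have [_] := hr t _ tab tr; rewrite [x t + _]addrC subrK => h.
apply: (le_trans h); apply: (@le_trans _ _ (eta / C * (C * `|y a - x a|))).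
  by rewrite ler_pM ?(ltW e0)// ?ge_min ?lexx ?bnd.
by rewrite mulrA divfK ?gt_eqF.
Qed.

End nearby_solutions.

(** * Liouville's formula *)



Lemma cvg_prod_ord (R : realType) (T : Type) (G : set_system T) (FG : Filter G)
    n (f : 'I_n -> T -> R) (l : 'I_n -> R) :
  (forall i, f i @ G --> l i) -> (fun s => \prod_i f i s) @ G --> \prod_i l i.
Proof.
move=> fl; apply: (@cvg_big R 'I_n (@GRing.mul R) 1 predT _ T G).
- by move=> /= z; exact: mul_continuous.
- by move=> i _; exact: fl.
Qed.

Lemma cvg_det (R : realType) (T : Type) (G : set_system T) (FG : Filter G)
    n (W : T -> 'M[R]_n) (M : 'M[R]_n) :
  (forall i j, (fun s => W s i j) @ G --> M i j) ->
  (fun s => \det (W s)) @ G --> \det M.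
Proof.
move=> WM; apply: (@cvg_big R {perm 'I_n} (@GRing.add R) 0 predT _ T G).
- by move=> /= z; exact: add_continuous.
- move=> s _; apply: cvgM; first exact: cvg_cst.
  exact: (@cvg_prod_ord R T G FG n (fun i t => W t i (s i))).
Qed.

Lemma normr_det_le (R : realType) n (M : 'M[R]_n) (C : R) :
  (forall i j, `|M i j| <= C) -> `|\det M| <= n`!%:R * C ^+ n.
Proof.
move=> hM; rewrite /determinant (le_trans (ler_norm_sum _ _ _))//.
apply: (@le_trans _ _ (\sum_(s : {perm 'I_n}) C ^+ n)).
  apply: ler_sum => s _; rewrite normrM normrX normrN1 expr1n mul1r normr_prod.
  rewrite -[X in C ^+ X]card_ord -prodr_const; apply: ler_prod => i _.
  by rewrite normr_ge0 hM.
by rewrite sumr_const card_Sn mulr_natl.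
Qed.

Lemma normr_adj_le (R : realType) n (M : 'M[R]_n.+1) (C : R) i j :
  (forall i j, `|M i j| <= C) -> `|\adj M i j| <= n`!%:R * C ^+ n.
Proof.
move=> hM; rewrite mxE /cofactor normrM normrX normrN1 expr1n mul1r.
by apply: normr_det_le => k l; rewrite !mxE.
Qed.

Lemma within_continuous_expRB (R : realType) (A : set R) (phi : R -> R) (c : R) :
  {within A, continuous phi} -> {within A, continuous (fun t => expR (c - phi
      t))}.
Proof.
move=> cphi t; apply: (@cvg_comp _ _ _ (fun t : subspace A => c - phi t) (@expR
    R)).
  by apply: cvgB (cphi t); exact: cvg_cst.
exact: continuous_expR.
Qed.

Section linearization.
Variables (R : realType) (n : nat) (D : set 'rV[R]_n.+1).
Variable F : R -> 'rV[R]_n.+1 -> 'rV[R]_n.+1.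
Hypotheses (oD : open D) (C1F : C1_field D F).
Variables (x : R -> 'rV[R]_n.+1) (a b : R).
Hypothesis ab : a <= b.
Hypothesis solx : solution D F `[a, b] x.

Local Notation sol y :=
  (forall t, t \in `[a, b] -> is_derive t 1 y (F t (y t))).

Let e (j : 'I_n.+1) : 'rV[R]_n.+1 := delta_mx 0 j.

(** A finite-difference substitute for the fundamental matrix of the variational equation; row [i]
    belongs to the initial displacement h e_i, so that it acts on row vectors from the right. *)
Definition difference_quotients (h : R) (Y : 'I_n.+1 -> R -> 'rV[R]_n.+1)
    (t : R) : 'M[R]_n.+1 :=
  \matrix_(i, j) (h^-1 * (Y i t 0 j - x t 0 j)).

Definition divergence (f : 'rV[R]_n.+1 -> 'rV[R]_n.+1) (y : 'rV[R]_n.+1) : R :=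
  \sum_i 'D_(e i) f y 0 i.

Lemma normr_delta_mx_le (h : R) i : `|h *: e i| <= `|h|.
Proof.
apply: normr_rV_le => // j; rewrite !mxE eqxx /=.
by case: eqP => _; rewrite ?mulr1// mulr0 normr0.
Qed.

Lemma initial_quotients h Y : h != 0 -> (forall i, Y i a = x a + h *: e i) ->
  difference_quotients h Y a = 1%:M.
Proof.
move=> h0 Ya; apply/matrixP => i j; rewrite !mxE Ya !mxE eqxx /=.
rewrite addrAC subrr add0r mulrA mulVf// mul1r.
by rewrite eq_sym.
Qed.

Let Dx t : t \in `[a, b] -> D (x t).
Proof. by move=> /solx[]. Qed.

Let dx t : t \in `[a, b] -> is_derive t 1 x (F t (x t)).
Proof. by move=> /solx[]. Qed.

Let cx t : t \in `[a, b] -> {for t, continuous x}.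
Proof. by move=> /dx; exact: is_derive_continuous. Qed.

Lemma is_derive_quotients h Y t : (forall i, sol (Y i)) -> t \in `[a, b] ->
  forall i j, is_derive t 1 (fun s => difference_quotients h Y s i j)
    (h^-1 * (F t (Y i t) 0 j - F t (x t) 0 j)).
Proof.
move=> hY tab i j.
have d1 := is_derive_coord 0 j (hY i t tab).
have d2 := is_derive_coord 0 j (dx tab).
have d3 := @is_deriveB R R R _ _ _ _ _ _ d1 d2.
have := @is_deriveZ R R R _ h^-1 _ _ _ d3.
congr (is_derive _ _ _ _); apply/funext => s.
by rewrite /difference_quotients mxE.
Qed.

(** The quotients satisfy W' = W J + E with [E] small, so Jacobi's formula gives (det W)' = div F
    det W + tr (E adj W). The integrating factor exp(phi b - phi t) removes the divergence term, and
    the mean value theorem bounds what the other term contributes. *)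
Lemma liouville (phi : R -> R) :
  {within `[a, b], continuous phi} ->
  (forall t, t \in `]a, b[ -> is_derive t 1 phi (divergence (F t) (x t))) ->
  forall eta, 0 < eta -> exists2 rho, 0 < rho & forall h Y,
  0 < `|h| < rho -> (forall i, sol (Y i)) ->
  (forall i, Y i a = x a + h *: e i) ->
  `|\det (difference_quotients h Y b) - expR (phi b - phi a)| <= eta.
Proof.
move=> cphi dphi eta eta0.
have [C C0 hC] := nearby_solution_linear oD C1F ab solx.
have [B B0 hB] : exists2 B, 0 < B & forall t, t \in `[a, b] -> expR (phi b -
    phi t) <= B.
  have [|c _ hc] := @EVT_max _ (fun t => expR (phi b - phi t)) a b ab.
    exact: within_continuous_expRB.
  by exists (expR (phi b - phi c)) => //; exact: expR_gt0.
pose N : R := n.+1%:R.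
(* The trace of [E *m \adj (W t)] has N^2 terms, and a cofactor is a determinant of order [n] with
   entries bounded by [C]. The summand 1 in [K] below keeps it positive when [a = b]. *)
pose A := N * (N * (n`!%:R * C ^+ n)).
have A0 : 0 <= A by rewrite !mulr_ge0// exprn_ge0// ltW.
pose K := (b - a) * (B * A) + 1.
have K0 : 0 < K.
  apply: ltr_wpDl => //; apply: mulr_ge0; first by rewrite subr_ge0.
  exact: mulr_ge0 (ltW B0) A0.
have [rho rho0 hrho] := hC (eta / K) (divr_gt0 eta0 K0).
exists rho => // h Y /andP[h0 hr] hY Ya.
have hn0 : h != 0 by rewrite -normr_gt0.
set W := difference_quotients h Y.
have Yxa i : `|Y i a - x a| <= `|h| by rewrite Ya addrAC subrr add0r
    normr_delta_mx_le.
have hYt i t : t \in `[a, b] -> `|Y i t - x t| <= C * `|h| /\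
  `|F t (Y i t) - F t (x t) - 'd (F t) (x t) (Y i t - x t)| <= eta / K * `|h|.
  move=> tab; have [|h1 h2] := hrho (Y i) (hY i) _ t tab.
    exact: le_lt_trans (Yxa i) hr.
  split; first by rewrite (le_trans h1)// ler_wpM2l// ltW.
  by rewrite (le_trans h2)// ler_wpM2l// ltW// divr_gt0.
pose dW t : 'M[R]_n.+1 := \matrix_(i, j) (h^-1 * (F t (Y i t) 0 j - F t (x t) 0
    j)).
have dWP t : t \in `[a, b] -> is_derive t 1 (fun s => \det (W s))
    (\tr (dW t *m \adj (W t))).
  move=> tab; apply: is_derive_det => i j; rewrite mxE.
  exact: is_derive_quotients.
have WC t i j : t \in `[a, b] -> `|W t i j| <= C.
  move=> tab; rewrite mxE normrM normfV mulrC ler_pdivrMr//.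
  have [h1 _] := hYt i t tab; apply: le_trans h1.
  by have := normr_rV_coord (Y i t - x t) j; rewrite !mxE.
pose J t : 'M[R]_n.+1 := \matrix_(i, j) 'D_(e i) (F t) (x t) 0 j.
pose E t := dW t - W t *m J t.
have EP t i j : t \in `[a, b] -> `|E t i j| <= eta / K.
  move=> tab; have [_ h2] := hYt i t tab.
  have [dF _] := C1F t (Dx tab).
  have -> : E t i j = h^-1 *
    (F t (Y i t) - F t (x t) - 'd (F t) (x t) (Y i t - x t)) 0 j.
    rewrite (diff_rV_sum (Y i t - x t) dF) !mxE [RHS]mulrBr; congr (_ - _).
    rewrite summxE mulr_sumr; apply: eq_bigr => k _.
    by rewrite !mxE mulrA.
  rewrite normrM normfV mulrC ler_pdivrMr//.
  by apply: le_trans h2; exact: normr_rV_coord.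
have trE t : t \in `[a, b] -> \tr (dW t *m \adj (W t)) =
    divergence (F t) (x t) * \det (W t) + \tr (E t *m \adj (W t)).
  move=> tab; rewrite -[dW t](subrK (W t *m J t)) -/(E t) mulmxDl mxtraceD addrC.
  congr (_ + _); rewrite mxtrace_mulC mulmxA mul_adj_mx mul_scalar_mx mxtraceZ.
  by rewrite mulrC /mxtrace; congr (_ * _); apply: eq_bigr => i _; rewrite mxE.
have trEle t : t \in `[a, b] -> `|\tr (E t *m \adj (W t))| <= A * (eta / K).
  move=> tab; rewrite (le_trans (ler_norm_sum _ _ _))// /A -mulrA.
  apply: ler_sum_const => i; rewrite mxE (le_trans (ler_norm_sum _ _ _))// -mulrA.
  apply: ler_sum_const => j; rewrite normrM mulrC ler_pM// ?EP//.
  by apply: normr_adj_le => k l; exact: WC.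
pose g t := \det (W t) * expR (phi b - phi t).
pose dg t := expR (phi b - phi t) * \tr (E t *m \adj (W t)).
have dgP t : t \in `]a, b[ -> is_derive t 1 g (dg t).
  move=> tab; have tab' : t \in `[a, b] by exact: subset_itv_oo_cc.
  have d1 := dWP t tab'; have d2 := dphi t tab.
  have d3 : is_derive t 1 (fun s => phi b - phi s) (- divergence (F t) (x t)).
    rewrite (_ : (fun _ => _) = cst (phi b) - phi); last exact/funext.
    by rewrite -[X in is_derive _ _ _ X]add0r; apply: is_deriveB.
  have d4 : is_derive t 1 (fun s => expR (phi b - phi s))
      (expR (phi b - phi t) * (- divergence (F t) (x t))).
    by apply: (is_derive1_comp (f := expR) (g := fun s : R => phi b - phi s)).
  have := @is_deriveM R R _ _ _ _ _ _ d1 d4.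
  congr (is_derive _ _ _ _); rewrite /dg /GRing.scale/= trE//; ring.
have cg : {within `[a, b], continuous g}.
  have c1 : {within `[a, b], continuous (fun t => \det (W t))}.
    apply: continuous_within_itv => t tab.
    exact: (is_derive_continuous (dWP t tab)).
  have c2 := within_continuous_expRB (c := phi b) cphi.
  by move=> t; apply: (cvgM (c1 t) (c2 t)).
have [t tab] := MVT_segment ab dgP cg.
have Wa : W a = 1%:M by exact: initial_quotients hn0 Ya.
rewrite /g subrr expR0 mulr1 Wa det1 mul1r => ->.
rewrite /dg normrM (ger0_norm (_ : 0 <= b - a)) ?subr_ge0//.
rewrite normrM ger0_norm ?expR_ge0//.
apply: (@le_trans _ _ (B * (A * (eta / K)) * (b - a))).
  by rewrite ler_wpM2r ?subr_ge0// ler_pM ?expR_ge0// ?hB// trEle.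
rewrite [leLHS](_ : _ = (b - a) * (B * A) * eta / K); last by ring.
rewrite ler_pdivrMr// mulrC ler_wpM2l ?(ltW eta0)//.
by rewrite /K lerDl.
Qed.

End linearization.



(** * The derivative of the solution map *)

Lemma normr_mulmx_le (R : realType) n (v : 'rV[R]_n.+1) (M : 'M[R]_n.+1) c :
  (forall i j, `|M i j| <= c) -> `|v *m M| <= n.+1%:R * (`|v| * c).
Proof.
move=> hM; have c0 : 0 <= c := le_trans (normr_ge0 _) (hM 0 0).
apply: normr_rV_le => [|j]; first by rewrite !mulr_ge0.
rewrite mxE (le_trans (ler_norm_sum _ _ _))//; apply: ler_sum_const => i.
by rewrite normrM ler_pM ?normr_rV_coord.
Qed.

Section solution_map.
Variables (R : realType) (n : nat) (D : set 'rV[R]_n.+1).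
Variable F : R -> 'rV[R]_n.+1 -> 'rV[R]_n.+1.
Hypotheses (oD : open D) (C1F : C1_field D F).
Variables (x : R -> 'rV[R]_n.+1) (a b : R).
Hypothesis ab : a <= b.
Hypothesis solx : solution D F `[a, b] x.

Local Notation sol y :=
  (forall t, t \in `[a, b] -> is_derive t 1 y (F t (y t))).

Let e (j : 'I_n.+1) : 'rV[R]_n.+1 := delta_mx 0 j.

Let Dx t : t \in `[a, b] -> D (x t).
Proof. by move=> /solx[]. Qed.

Let dx t : t \in `[a, b] -> is_derive t 1 x (F t (x t)).
Proof. by move=> /solx[]. Qed.

Let cx t : t \in `[a, b] -> {for t, continuous x}.
Proof. by move=> /dx; exact: is_derive_continuous. Qed.

(** The difference [u] between [y - x] and the combination of quotients with the same initial value
    starts at 0 and solves the linearized equation up to small remainders, so Gronwall's estimate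
    keeps it small. Solutions are compared with solutions, and no linear equation has to be
    solved. *)
Lemma quotients_linear eta : 0 < eta -> exists2 rho, 0 < rho & forall h Y y,
  0 < `|h| < rho -> (forall i, sol (Y i)) ->
  (forall i, Y i a = x a + h *: e i) ->
  sol y -> `|y a - x a| < rho ->
  `|(y b - x b) - (y a - x a) *m difference_quotients x h Y b| <=
    eta * `|y a - x a|.
Proof.
move=> eta0; have [L L0 hL] := diff_bounded C1F ab Dx cx.
pose G := gronwall_constant n L (b - a).
have G0 : 0 < G.
  by apply: lt_le_trans ltr01 _; apply: gronwall_constant_ge1; rewrite ?subr_ge0.
pose N : R := n.+1%:R.
have N0 : 0 <= N by [].
have [C C0 hC] := nearby_solution_linear oD C1F ab solx.
(* One remainder comes from [y] and [n.+1] from the [Y i]; [G] is their amplification over the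
   interval. *)
have k0 : 0 < eta / (G * (1 + N)) by rewrite divr_gt0// mulr_gt0// ltr_wpDr.
have [rho rho0 hrho] := hC _ k0.
set k := eta / _ in k0 hrho.
exists rho => // h Y y /andP[h0 hr] hY Ya hy yr.
have hn0 : h != 0 by rewrite -normr_gt0.
pose va := y a - x a.
have hYt i t : t \in `[a, b] ->
    `|F t (Y i t) - F t (x t) - 'd (F t) (x t) (Y i t - x t)| <= k * `|h|.
  have Yxa : `|Y i a - x a| <= `|h|.
    by rewrite Ya addrAC subrr add0r normr_delta_mx_le.
  move=> tab; have [|_ h2] := hrho (Y i) (hY i) _ t tab.
    exact: le_lt_trans Yxa hr.
  by rewrite (le_trans h2)// ler_wpM2l// ltW.
pose u t := (y t - x t) - \sum_i va 0 i *: (h^-1 *: (Y i t - x t)).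
pose du t := (F t (y t) - F t (x t)) -
  \sum_i va 0 i *: (h^-1 *: (F t (Y i t) - F t (x t))).
have duP t : t \in `[a, b] -> is_derive t 1 u (du t).
  move=> tab; have d0 := dx tab; have dy := hy t tab.
  have ds (i : 'I_n.+1) : is_derive t 1 (va 0 i *: (h^-1 *: (Y i - x)))
      (va 0 i *: (h^-1 *: (F t (Y i t) - F t (x t)))).
    have dYi := hY i t tab.
    have d1 := @is_deriveB R R _ _ _ _ _ _ _ dYi d0.
    have d2 := @is_deriveZ R R _ _ h^-1 _ _ _ d1.
    exact: (@is_deriveZ R R _ _ (va 0 i) _ _ _ d2).
  have d3 := @is_derive_sum _ _ _ _ _ _ _ _ ds.
  have d4 := @is_deriveB R R _ _ _ _ _ _ _ dy d0.
  have := @is_deriveB R R _ _ _ _ _ _ _ d4 d3.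
  congr (is_derive _ _ _ _); apply/funext => s.
  by rewrite /u /= [in LHS]/GRing.add/= /GRing.opp/= fct_sumE.
have uE t : u t = (y t - x t) - va *m difference_quotients x h Y t.
  rewrite /u mulmx_sum_row; congr (_ - _); apply: eq_bigr => i _.
  by congr (_ *: _); apply/rowP => j; rewrite !mxE.
rewrite -/va -uE.
have ua : u a = 0.
  by rewrite uE (initial_quotients hn0 Ya) mulmx1 subrr.
apply: (@le_trans _ _ (G * (`|u a| + k * (1 + N) * `|va|))); last first.
  have kE : G * (k * (1 + N)) = eta.
    by rewrite /k; field; rewrite !gt_eqF// ltr_wpDr.
  by rewrite ua normr0 add0r mulrA kE.
apply: (gronwall ab L0 _ duP) => [|t tab'].
  have N1 : 0 <= 1 + N by rewrite addr_ge0.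
  exact: mulr_ge0 (mulr_ge0 (ltW k0) N1) (normr_ge0 _).
have tab : t \in `[a, b] by exact: subset_itv_oo_cc.
pose r (z : R -> 'rV[R]_n.+1) := F t (z t) - F t (x t) - 'd (F t) (x t) (z t -
    x t).
have duE : du t = 'd (F t) (x t) (u t) +
    (r y - \sum_i va 0 i *: (h^-1 *: r (Y i))).
  have -> : 'd (F t) (x t) (u t) = 'd (F t) (x t) (y t - x t) -
      \sum_i va 0 i *: (h^-1 *: 'd (F t) (x t) (Y i t - x t)).
    rewrite /u linearB linear_sum; congr (_ - _); apply: eq_bigr => i _.
    by rewrite linearZ; congr (_ *: _); rewrite linearZ.
  rewrite /du /r [RHS]addrACA subrKC -opprD -big_split/=; congr (_ - _).
  by apply: eq_bigr => i _; rewrite -!scalerDr subrKC.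
rewrite duE (le_trans (ler_normD _ _))// lerD ?hL//.
rewrite (le_trans (ler_normB _ _))// mulrDr mulr1 mulrDl lerD//.
  by have [] := hrho y hy yr t tab.
rewrite (le_trans (ler_norm_sum _ _ _))// [k * N]mulrC -mulrA.
apply: ler_sum_const => i; rewrite !normrZ mulrC ler_pM ?normr_rV_coord//.
by rewrite normfV mulrC ler_pdivrMr// hYt.
Qed.

(** Solutions displaced along the basis vectors by [hk k], which tends to 0 and stays below [r0],
    give quotient matrices [W k]. Their limit [M] takes its determinant from Liouville's formula and
    its linear approximation from [quotients_linear]. *)
Lemma solution_map_derivative (phi : R -> R) :
  {within `[a, b], continuous phi} ->
  (forall t, t \in `]a, b[ -> is_derive t 1 phi (divergence (F t) (x t))) ->
  (exists2 r0, 0 < r0 & forall y0, `|y0 - x a| < r0 ->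
    exists2 y, sol y & y a = y0) ->
  exists2 M, \det M = expR (phi b - phi a) &
  forall eta, 0 < eta -> exists2 rho, 0 < rho & forall y,
  sol y -> `|y a - x a| < rho ->
  `|(y b - x b) - (y a - x a) *m M| <= eta * `|y a - x a|.
Proof.
move=> cphi dphi [r0 r00 hr0].
pose hk (k : nat) : R := r0 / 2 * k.+1%:R^-1.
have hk0 k : 0 < hk k by rewrite !mulr_gt0 ?invr_gt0.
have hkr k : hk k < r0.
  rewrite /hk -mulrA gtr_pMr// (@le_lt_trans _ _ (2^-1))//.
    by rewrite ger_pMr// invf_le1// ler1n.
  by rewrite invf_lt1// ltr1n.
have hksmall rho : 0 < rho -> \forall k \near \oo, hk k < rho.
  move=> rho0; have := nbhs_infty_gtr (r0 / 2 / rho).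
  apply: filterS => k; rewrite ltr_pdivrMr// => /lt_le_trans hk1.
  rewrite /hk ltr_pdivrMr// [ltRHS]mulrC; apply: hk1.
  by rewrite ler_wpM2r ?ler_nat// ltW.
have /choice[Y hY] (k : nat) : exists Y : 'I_n.+1 -> R -> 'rV[R]_n.+1,
    (forall i, sol (Y i)) /\ (forall i, Y i a = x a + hk k *: e i).
  have /choice[Y hY] (i : 'I_n.+1) : exists y, sol y /\ y a = x a + hk k *: e i.
    have [|y y1 y2] := hr0 (x a + hk k *: e i); last by exists y.
    rewrite addrAC subrr add0r (le_lt_trans (normr_delta_mx_le _ _))//.
    by rewrite gtr0_norm.
  by exists Y; split=> i; case: (hY i).
pose W k := difference_quotients x (hk k) (Y k) b.
(* The matrix [W k] is tested on the solution [Y l i] itself: its displacement at [b] is [hk l]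
   times row [i] of [W l], while the linear prediction is [hk l] times row [i] of [W k]. *)
have Wcauchy eta : 0 < eta -> \forall k \near \oo, forall l, hk l <= hk k ->
    forall i j, `|W l i j - W k i j| <= eta.
  move=> eta0; have [rho rho0 hrho] := quotients_linear eta0.
  near=> k => l hlk i j.
  have hkrho : hk k < rho by near: k; exact: hksmall.
  have Ya : Y l i a - x a = hk l *: e i.
    by case: (hY l) => _ ->; rewrite addrAC subrr add0r.
  have nYa : `|Y l i a - x a| <= hk l.
    by rewrite Ya (le_trans (normr_delta_mx_le _ _))// gtr0_norm.
  have := hrho (hk k) (Y k) (Y l i).
  rewrite normr_gt0 gt_eqF ?hk0//= gtr0_norm// hkrho.
  move=> /(_ isT (hY k).1 (hY k).2 ((hY l).1 i) (le_lt_trans nYa (le_lt_trans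
      hlk hkrho))).
  move=> H; have := le_trans (normr_rV_coord _ j) H.
  have -> : ((Y l i b - x b) - (Y l i a - x a) *m W k) 0 j =
      hk l * (W l i j - W k i j).
    rewrite Ya -scalemxAl -rowE !mxE [RHS]mulrBr; congr (_ - _).
    by rewrite mulrA divff ?mul1r// gt_eqF.
  rewrite normrM gtr0_norm// => H'.
  rewrite -(ler_pM2l (hk0 l)) (le_trans H')// mulrC ler_wpM2r//.
  exact: ltW.
have hk_decr k l : (k <= l)%N -> hk l <= hk k.
  move=> kl; rewrite /hk ler_wpM2l ?divr_ge0 ?(ltW r00)//.
  by rewrite lef_pV2 ?posrE// ler_nat.
have Wcvg i j : cvg ((fun k => W k i j) @ \oo).
  apply/cauchy_cvgP/cauchy_exP => eta eta0.
  have e2 : 0 < eta / 2 by rewrite divr_gt0.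
  have [k _ hk1] := Wcauchy _ e2.
  exists (W k i j); exists k => // l /= kl.
  rewrite -ball_normE /ball_/= distrC.
  apply: le_lt_trans (hk1 k (leqnn k) l (hk_decr _ _ kl) i j) _.
  by rewrite ltr_pdivrMr// ltr_pMr// ltr1n.
pose M : 'M[R]_n.+1 := \matrix_(i, j) lim ((fun k => W k i j) @ \oo).
have WM i j : (fun k => W k i j) @ \oo --> M i j by rewrite mxE; exact: Wcvg.
exists M.
  have dW : (fun k => \det (W k)) @ \oo --> \det M by exact: cvg_det.
  rewrite -(cvg_lim (@norm_hausdorff _ R) dW); apply: cvg_lim => //.
  apply/cvgrPdist_le => eta eta0.
  have [rho rho0 hrho] := liouville oD C1F ab solx cphi dphi eta0.
  apply: filterS (hksmall _ rho0) => k hkrho; rewrite distrC.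
  have hk2 : 0 < `|hk k| < rho by rewrite gtr0_norm// hk0 hkrho.
  exact: (hrho (hk k) (Y k) hk2 (hY k).1 (hY k).2).
move=> eta eta0; have e2 : 0 < eta / 2 by rewrite divr_gt0.
have [rho rho0 hrho] := quotients_linear e2.
have e3 : 0 < eta / 2 / n.+1%:R by rewrite divr_gt0.
have [k [hkrho hkM]] : exists k, hk k < rho /\
    forall i j, `|W k i j - M i j| <= eta / 2 / n.+1%:R.
  have : \forall k \near \oo, hk k < rho /\
    forall i j, `|W k i j - M i j| <= eta / 2 / n.+1%:R.
    near=> k; split; first by near: k; exact: hksmall.
    near: k; apply: filter_forall => i; apply: filter_forall => j.
    have /cvgrPdist_le /(_ _ e3) := WM i j.
    by apply: filterS => k; rewrite distrC.
  by move=> [k _ /(_ k (leqnn k))]; exists k.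
exists rho => // y hy yr.
have H := hrho (hk k) (Y k) y.
rewrite normr_gt0 gt_eqF ?hk0//= gtr0_norm// hkrho in H.
have {}H := H isT (hY k).1 (hY k).2 hy yr.
rewrite -[X in `|X|](subrKA ((y a - x a) *m W k)).
rewrite (le_trans (ler_normD _ _))// [eta in leRHS]splitr mulrDl lerD//.
rewrite -mulmxBr.
have hkM' i j : `|(W k - M) i j| <= eta / 2 / n.+1%:R.
  have -> : (W k - M) i j = W k i j - M i j by rewrite [LHS]mxE [X in _ + X]mxE.
  exact: hkM.
rewrite (le_trans (normr_mulmx_le _ hkM'))//.
by rewrite mulrCA mulrC [n.+1%:R * _]mulrC divfK ?pnatr_eq0.
Unshelve. all: by end_near. Qed.

End solution_map.

(** * Instability from volume expansion *)



Lemma open_normr_ball (R : realType) (V : normedModType R) (D : set V) y :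
  open D -> D y -> exists2 d : R, 0 < d & forall y0, `|y0 - y| < d -> D y0.
Proof.
move=> oD Dy; have /nbhs_ballP[d /= d0 hd] : nbhs y D.
  by apply: open_nbhs_nbhs; split.
by exists d => // y0 h; apply: hd; rewrite -ball_normE /ball_/= distrC.
Qed.

Lemma is_derive1_compV (R : realType) (V : normedModType R) (g : R -> R)
    (y : R -> V) (t dg : R) (dy : V) :
  is_derive t 1 g dg -> is_derive (g t) 1 y dy ->
  is_derive t 1 (y \o g) (dg *: dy).
Proof.
move=> [g1 g2] [y1 y2].
have dfg : differentiable g t by exact/derivable1_diffP.
have dfy : differentiable y (g t) by exact/derivable1_diffP.
have dfyg : differentiable (y \o g) t by exact: differentiable_comp.
split; first exact/derivable1_diffP.
rewrite deriveE// diff_comp//= -g2 -y2 !deriveE//.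
by rewrite -[X in 'd y _ X = _]mulr1 -[X in 'd y _ X = _]/(_ *: _) linearZ.
Qed.

(** Stability would serve twice: with tolerance 1 it provides the solutions from which the
    derivative [M] of the period map is obtained, and with tolerance [rho] it confines orbits to the
    ball where that map is linear up to [kappa]. Sampled once per period, two confined orbits then
    contradict [expanding_pair]. *)
Lemma unstable_of_expanding_volume (R : realType) n (D : set 'rV[R]_n.+1)
    (F : R -> 'rV[R]_n.+1 -> 'rV[R]_n.+1) (x : R -> 'rV[R]_n.+1)
    (s tau : R) (phi : R -> R) :
  open D -> C1_field D F -> 0 < tau ->
  (forall t y, D y -> F (t + tau) y = F t y) ->
  solution D F setT x -> periodic x tau ->
  {within `[s, s + tau], continuous phi} ->
  (forall t, t \in `]s, s + tau[ ->
    is_derive t 1 phi (divergence (F t) (x t))) ->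
  phi s < phi (s + tau) ->
  lyapunov_unstable D F x.
Proof.
move=> oD C1F tau0 Ftau solx xtau cphi dphi phis stab.
pose b := s + tau.
have sb : s <= b by rewrite lerDl ltW.
have solx' : solution D F `[s, b] x by move=> t _; exact: solx.
have Ds : D (x s) by case: (solx s).
have [d d0 hd] := open_normr_ball oD Ds.
have [M detM Mlin] : exists2 M, \det M = expR (phi b - phi s) &
  forall eta, 0 < eta -> exists2 rho, 0 < rho & forall y,
  (forall t, t \in `[s, b] -> is_derive t 1 y (F t (y t))) ->
  `|y s - x s| < rho ->
  `|(y b - x b) - (y s - x s) *m M| <= eta * `|y s - x s|.
  apply: (solution_map_derivative oD C1F sb solx' cphi dphi).
  have [rho rho0 hrho] := stab s 1 ltr01.
  exists (Num.min rho d); first by rewrite lt_min rho0.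
  move=> y0; rewrite lt_min => /andP[h1 h2].
  have [[y [soly ys]] _] := hrho y0 (hd _ h2) h1.
  exists y => // t; rewrite in_itv/= => /andP[st _].
  by have [|_] := soly t; rewrite //= in_itv/= st.
have detM1 : 1 < `|\det M|.
  by rewrite detM ger0_norm ?expR_ge0// -expR0 ltr_expR subr_gt0.
have [kappa kappa0 [u [v huv]]] := expanding_pair detM1.
have [rho rho0 hrho] := Mlin _ kappa0.
have [rhos rhos0 hrhos] := stab s rho rho0.
(* Small enough for both starting points to lie in [D] and within the radius given by stability. *)
pose h := Num.min rhos d / 2 / (1 + `|u| + `|v|).
have q0 : 0 < 1 + `|u| + `|v| by rewrite ltr_wpDr// ltr_wpDr.
have m0 : 0 < Num.min rhos d by rewrite lt_min rhos0.
have h0 : 0 < h by rewrite !divr_gt0.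
have small w : `|w| <= 1 + `|u| + `|v| -> `|h *: w| < Num.min rhos d.
  move=> hw; rewrite normrZ gtr0_norm// /h.
  apply: (@le_lt_trans _ _ (Num.min rhos d / 2)); last first.
    by rewrite ltr_pdivrMr// ltr_pMr// ltr1n.
  by rewrite mulrAC ler_pdivrMr// ler_wpM2l// divr_ge0// ltW.
have Fk k t y : D y -> F (t + tau *+ k) y = F t y.
  move=> Dy; elim: k => [|k ih]; first by rewrite mulr0n addr0.
  by rewrite mulrSr addrA Ftau.
have iterates w : `|w| <= 1 + `|u| + `|v| -> exists y : nat -> 'rV[R]_n.+1,
    [/\ y 0%N = h *: w,
        (forall k, `|y k.+1 - y k *m M| <= kappa * `|y k|) &
        (forall k, `|y k| < rho)].
  move=> /small; rewrite lt_min => /andP[w1 w2].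
  have w1' : `|x s + h *: w - x s| < rhos by rewrite addrAC subrr add0r.
  have w2' : `|x s + h *: w - x s| < d by rewrite addrAC subrr add0r.
  have [[y [soly ys]] bnd] := hrhos (x s + h *: w) (hd _ w2') w1'.
  have {}bnd := bnd y soly ys.
  have stk k : s <= s + tau *+ k by rewrite lerDl mulrn_wge0// ltW.
  exists (fun k => y (s + tau *+ k) - x s); split.
  - by rewrite mulr0n addr0 ys addrAC subrr add0r.
  (* By periodicity of [F], the solution translated by [k] periods solves the same equation on the
     first period. *)
  - move=> k; pose yk t := y (t + tau *+ k).
    have solyk t : t \in `[s, b] -> is_derive t 1 yk (F t (yk t)).
      rewrite in_itv/= => /andP[st _].
      have [|Dy dy] := soly (t + tau *+ k).
        by rewrite /= in_itv/= andbT (le_trans (stk k))// lerD2r.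
      rewrite -(Fk k t _ Dy).
      have := is_derive1_compV (is_derive_shift t 1 (tau *+ k)) dy.
      by rewrite scale1r.
    have E : yk s - x s = y (s + tau *+ k) - x s by [].
    have := hrho yk solyk; rewrite E => /(_ _).
    have -> : yk b = y (s + tau *+ k.+1) by rewrite /yk /b mulrSr addrAC addrA.
    rewrite {1}/b xtau; apply.
    by have := bnd _ (stk k); rewrite (periodicn xtau).
  - by move=> k; have := bnd _ (stk k); rewrite (periodicn xtau).
have [|yu [yu0 yuM yur]] := iterates u; first by rewrite -addrA addrCA lerDl
    addr_ge0.
have [|yv [yv0 yvM yvr]] := iterates v; first by rewrite lerDr addr_ge0.
have [k] := huv h h0 yu yv yu0 yv0 yuM yvM (rho + rho).
by rewrite ltNge => /negP; apply; rewrite lerD ?ltW.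
Qed.

(** * The unperturbed period map *)



Lemma is_diff_fst (R : realType) (V W : normedModType R) (z : V * W) :
  is_diff z (fst : V * W -> V) (fst : V * W -> V).
Proof.
have c : continuous (fst : {linear (V * W)%type -> V}) by move=> w; exact:
    cvg_fst.
by split; [exact: (linear_differentiable _ c)|exact: (diff_lin _ c)].
Qed.

Lemma is_diff_snd (R : realType) (V W : normedModType R) (z : V * W) :
  is_diff z (snd : V * W -> W) (snd : V * W -> W).
Proof.
have c : continuous (snd : {linear (V * W)%type -> W}) by move=> w; exact:
    cvg_snd.
by split; [exact: (linear_differentiable _ c)|exact: (diff_lin _ c)].
Qed.

Lemma periodic_int (R : realType) (V : zmodType) (f : R -> V) (T : R) (k : int)
    t :
  periodic f T -> f (t + k%:~R * T) = f t.
Proof.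
move=> fT; case: k => k.
  by rewrite -pmulrn mulr_natl periodicn.
rewrite NegzE mulrNz mulNr -pmulrn.
by rewrite -(periodicn fT k.+1 (t - k.+1%:R * T)) -[T *+ _]mulr_natl subrK.
Qed.

Lemma diff_near_id (R : realType) (V W : normedModType R) (g : W -> V) (h : V
    -> W)
    (y v : V) :
  differentiable h y -> differentiable g (h y) ->
  (\forall u \near y, g (h u) = u) -> 'd g (h y) ('d h y v) = v.
Proof.
move=> dh dg gh.
have E : 'D_v (g \o h) y = 'D_v id y by exact: near_eq_derive.
rewrite derive_id deriveE in E; last exact: differentiable_comp.
by rewrite diff_comp in E.
Qed.

Lemma linear_form_rV (R : comNzRingType) n (c : 'rV[R]_n -> R) :
  (forall a u v, c (a *: u + v) = a * c u + c v) ->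
  forall v, v *m (\col_i c (delta_mx 0 i)) = (c v)%:M.
Proof.
move=> cP v; have c0 : c 0 = 0.
  by have := cP (-1) 0 0; rewrite scaler0 addr0 mulN1r addNr.
rewrite [in RHS](row_sum_delta v).
apply/matrixP => i j; rewrite !ord1 !mxE eqxx mulr1n.
rewrite (eq_bigr (fun i => v 0 i * c (delta_mx 0 i))); last by move=> k _;
    rewrite !mxE.
elim/big_rec2 : _ => [|k y1 y2 _ ->]; first by rewrite c0.
by rewrite cP.
Qed.

Section unperturbed.
Variables (R : realType) (p : nat) (D : set 'rV[R]_p.+1).
Variable f0 : 'rV[R]_p.+1 -> 'rV[R]_p.+1.
Variables (T : R) (P : 'rV[R]_p.+1 -> R) (L : set 'rV[R]_p).
Variables (x0 : 'rV[R]_p -> 'rV[R]_p.+1) (q : 'rV[R]_p -> R -> 'rV[R]_p.+1).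
Hypotheses (T0 : 0 < T) (oD : open D) (CP : C1_period D f0 P).
Hypothesis solq : forall xi, L xi -> solution D (fun=> f0) setT (q xi) /\ q xi
    0 = x0 xi.
Let G := action_angle T P x0 q.
Let Om := frequency T P x0.
Hypothesis diffeoG : circle_diffeomorphism T L D G.

Lemma period_gt0 J : L J -> 0 < P (x0 J).
Proof.
move=> LJ; have [sol <-] := solq LJ.
by have [_ /(_ _ sol)[]] := CP.
Qed.

(** The factor P / T in [G] cancels the frequency T / P, so that the unperturbed flow translates the
    angle at the constant speed [Om J]. *)
Lemma flow_solution J th s : L J ->
  solution D (fun=> f0) setT (fun t => G (J, th + Om J * (t - s))).
Proof.
move=> LJ t _; have P0 := period_gt0 LJ.
pose c := P (x0 J) / T * th - s.
have E r : G (J, th + Om J * (r - s)) = q J (r + c).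
  rewrite /G /action_angle /= /Om /frequency; congr (q J _).
  by rewrite /c; field; rewrite !gt_eqF.
have [sol _] := solq LJ; have [Dq dq] := sol (t + c) I.
split; first by rewrite E.
have := is_derive1_compV (is_derive_shift t 1 c) dq.
rewrite scale1r -E; congr (is_derive _ _ _ _).
by apply/funext => r; rewrite /= E.
Qed.

(** This makes the period differentiable in the action, as the composite of [P] and [G]; no
    smoothness is assumed of [x0] itself. *)
Lemma section_point J : L J -> x0 J = G (J, 0).
Proof. by move=> LJ; rewrite /G /action_angle /= mulr0; have [_ ->] := solq LJ.
    Qed.

(* The period map is G o S o G^-1 for the shear S (J, th) = (J, th + tau Om J),
   so its derivative at a fixed point differs from the identity by a matrix of
   square zero: hence it has determinant 1. *)
Lemma unperturbed_trace (xx : R -> 'rV[R]_p.+1) (s tau : R) (phi : R -> R) :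
  C1_field D (fun=> f0) -> 0 < tau ->
  solution D (fun=> f0) setT xx -> periodic xx tau ->
  {within `[s, s + tau], continuous phi} ->
  (forall t, t \in `]s, s + tau[ -> is_derive t 1 phi (divergence f0 (xx t))) ->
  phi (s + tau) = phi s.
Proof.
move=> C1f tau0 solxx xxtau cphi dphi.
pose b := s + tau; have sb : s <= b by rewrite lerDl ltW.
have solxx' : solution D (fun=> f0) `[s, b] xx by move=> t _; exact: solxx.
have [Gper GD Ginj [dG _] Hloc] := diffeoG.
pose xs := xx s; have Dxs : D xs by case: (solxx s).
have [U [H [oU Uxs UD [dH _] HU]]] := Hloc _ Dxs.
pose J := (H xs).1; pose th := (H xs).2.
have LJ : L J by case: (HU _ Uxs).
have HxsE : H xs = (J, th) by rewrite /J /th; case: (H xs).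
have GH : G (J, th) = xs by rewrite -HxsE; case: (HU _ Uxs).
pose Y u t := G ((H u).1, (H u).2 + Om (H u).1 * (t - s)).
have Ysol u : U u -> solution D (fun=> f0) setT (Y u).
  by move=> Uu; apply: flow_solution; case: (HU _ Uu).
have Ysol' u : U u -> forall t, t \in `[s, b] -> is_derive t 1 (Y u) (f0 (Y u t)).
  by move=> Uu t _; case: (Ysol u Uu t).
have Ys u : U u -> Y u s = u.
  by move=> Uu; rewrite /Y subrr mulr0 addr0 -surjective_pairing; case: (HU _ Uu).
(* Uniqueness: [Y xs] and [xx] agree at [s], and the Lipschitz bound with initial distance 0 makes
   them agree at [b]. *)
have Yxs : Y xs b = xs.
  have [C C0 hC] := nearby_solution_linear oD C1f sb solxx'.
  have [rho rho0 hrho] := hC 1 ltr01.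
  have := hrho (Y xs) (Ysol' xs Uxs); rewrite (Ys _ Uxs) subrr normr0.
  move=> /(_ rho0 b); rewrite in_itv/= lexx sb => /(_ isT)[+ _].
  by rewrite mulr0 normr_le0 subr_eq0 => /eqP ->; rewrite /b xxtau.
have [k hk] : exists k : int, Om J * tau = k%:~R * T.
  have : G (J, th + Om J * tau) = G (J, th).
    by rewrite GH -[RHS]Yxs /Y HxsE /b /= addrAC subrr add0r.
  move=> /(Ginj (J, th + Om J * tau) (J, th) LJ LJ)[_ [k /=]].
  by rewrite addrAC subrr add0r => hk; exists k.
(* The advance of the angle during [tau], less the [k] full turns made at [J]. The shear [S] then
   fixes the lift [(J, th)] itself and not only its class modulo [T]. *)
pose g (K : 'rV[R]_p) : R := T * (P (G (K, 0)))^-1 * tau - k%:~R * T.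
have dg : differentiable g J.
  have d1 : differentiable (fun K : 'rV[R]_p => (K, 0 : R)) J.
    exact: differentiable_pair.
  have d2 : differentiable (fun K : 'rV[R]_p => G (K, 0)) J.
    by apply: (differentiable_comp d1); apply: dG.
  have d3 : differentiable (fun K : 'rV[R]_p => P (G (K, 0))) J.
    apply: (differentiable_comp d2); have [[dP _] _] := CP.
    by apply: dP; rewrite -GD; exists (J, 0).
  have PJ : P (G (J, 0)) != 0 by rewrite -section_point// gt_eqF// period_gt0.
  have d4 := differentiableV d3 PJ.
  have d5 := @differentiableZ _ _ _ _ T _ d4.
  have d6 := @differentiableZ _ _ _ _ tau _ d5.
  have d7 := @differentiableB _ _ _ _ _ _ d6 (differentiable_cst (k%:~R * T) J).
  rewrite (_ : g = tau *: (T *: (fun K : 'rV[R]_p => (P (G (K, 0)))^-1)) -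
    cst (k%:~R * T)); first exact: d7.
  by apply/funext => K; rewrite /g /= [_ * tau]mulrC.
have gJ : g J = 0.
  by rewrite /g -section_point// -/(Om J) hk subrr.
pose S (w : 'rV[R]_p * R) := (w.1, w.2 + g w.1).
pose Phi u := G (S (H u)).
have YPhi u : U u -> Y u b = Phi u.
  move=> Uu; have [LH _] := HU _ Uu.
  rewrite /Y /Phi /S /g -section_point// -/(Om _).
  rewrite /b [s + tau]addrC addrK.
  rewrite -[RHS](periodic_int k _ (Gper _ LH)); congr (G (_, _)).
  by rewrite /Om /frequency; ring.
pose dgJ : 'rV[R]_p -> R := 'd g J.
have dS : is_diff (J, th) S (fun w => (w.1, w.2 + dgJ w.1)).
  have h1 := is_diff_fst (J, th); have h2 := is_diff_snd (J, th).
  have h3 : is_diff ((J, th).1) g dgJ by exact: differentiableP.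
  have h4 := @is_diff_comp _ _ _ _ _ _ _ _ _ h1 h3.
  have h5 := @is_diffD _ _ _ _ _ _ _ _ h2 h4.
  exact: is_diff_pair h1 h5.
have SJ : S (J, th) = (J, th) by rewrite /S /= gJ addr0.
have dHx : differentiable H xs by exact: dH.
have dGx : differentiable G (J, th) by exact: dG.
(* [ev] is the derivative of [G] in the angle, and [c] the variation of the angle advance; the
   differential of the period map is v + c(v) ev. *)
pose ev := 'd G (J, th) (0, 1).
pose c (v : 'rV[R]_p.+1) : R := dgJ ('d H xs v).1.
have dPhi : differentiable Phi xs /\ forall v, 'd Phi xs v = v + c v *: ev.
  have i1 := differentiableP dHx.
  have i2 : is_diff (H xs) S (fun w => (w.1, w.2 + dgJ w.1)) by rewrite HxsE.
  have i3 : is_diff (S (H xs)) G ('d G (J, th)).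
    by rewrite HxsE SJ; exact: differentiableP.
  have i4 := @is_diff_comp _ _ _ _ _ _ _ _ _ i1 i2.
  have i5 := @is_diff_comp _ _ _ _ _ _ _ _ _ i4 i3.
  split; first by case: i5.
  move=> v; have -> : 'd Phi xs v = ('d G (J, th) \o
      ((fun w => (w.1, w.2 + dgJ w.1)) \o 'd H xs)) v by case: i5 => _ <-.
  rewrite /=; have -> : (('d H xs v).1, ('d H xs v).2 + dgJ ('d H xs v).1) =
      'd H xs v + c v *: (0 : 'rV[R]_p, 1 : R).
    rewrite /c; case: ('d H xs v) => w1 w2 /=.
    by congr (_, _); rewrite /= ?scaler0 ?addr0// /GRing.scale/= mulr1.
  rewrite linearD linearZ; congr (_ + _).
  rewrite -HxsE; apply: diff_near_id => //; first by rewrite HxsE.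
  by near=> u; have [|_ ->] := HU u; [near: u; exact: open_nbhs_nbhs|].
(* Moving the angle does not change the action. The local inverse [H] may return an angle that
   differs by a multiple of [T], but its first component is [J] by injectivity of [G]. *)
have cev : c ev = 0.
  rewrite /c /ev.
  suff -> : ('d H xs ('d G (J, th) (0, 1))).1 = 0 by rewrite /dgJ linear0.
  pose line (r : R) : 'rV[R]_p * R := (J, th + r).
  have line0 : line 0 = (J, th) by rewrite /line addr0.
  have dl : is_diff (0 : R) line (fun r => (0, r)).
    have d1 := @is_diff_cst _ R _ J (0 : R).
    have d2 := @is_diffD _ _ _ _ _ _ _ _ (@is_diff_cst _ R R th 0) (is_diff_id
        (0 : R)).
    have [d3 d4] := is_diff_pair d1 d2; split => //.
    by rewrite [LHS]d4; apply/funext => r /=; rewrite add0r.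
  have i1 : is_diff (line 0) G ('d G (J, th)).
    by rewrite line0; exact: differentiableP.
  have i2 := @is_diff_comp _ _ _ _ _ _ _ _ _ dl i1.
  have i3 : is_diff ((G \o line) 0) H ('d H xs).
    by rewrite /= line0 GH; exact: differentiableP.
  have i4 := @is_diff_comp _ _ _ _ _ _ _ _ _ i2 i3.
  have i5 := @is_diff_comp _ _ _ _ _ _ _ _ _ i4 (is_diff_fst _).
  have [i6 i7] := i5.
  have -> : ('d H xs ('d G (J, th) (0, 1))).1 = 'd (fst \o (H \o (G \o line)))
      0 1.
    by rewrite i7.
  rewrite -deriveE// -(derive_cst J (0 : R) 1).
  apply: near_eq_derive.
  have cGl : {for 0, continuous (G \o line)}.
    by apply: differentiable_continuous; case: i2.
  have UGl : nbhs ((G \o line) 0) U.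
    by rewrite /= line0 GH; exact: open_nbhs_nbhs.
  have n0 : nbhs (0 : R) (fun r => U (G (line r))) := cGl _ UGl.
  apply: (@filterS _ _ (nbhs_filter (0 : R)) _ _ _ n0) => r Ur.
  have [LH GHl] := HU _ Ur.
  by have [] := Ginj (H (G (line r))) (line r) LH LJ GHl.
have [M detM Mlin] : exists2 M, \det M = expR (phi b - phi s) &
  forall eta, 0 < eta -> exists2 rho, 0 < rho & forall y,
  (forall t, t \in `[s, b] -> is_derive t 1 y (f0 (y t))) ->
  `|y s - xx s| < rho ->
  `|(y b - xx b) - (y s - xx s) *m M| <= eta * `|y s - xx s|.
  apply: (solution_map_derivative oD C1f sb solxx' cphi dphi).
  have [d d0 hd] := open_normr_ball oU Uxs.
  exists d => // y0 /hd Uy0; exists (Y y0); [exact: Ysol'|exact: Ys].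
have [dPhi1 dPhi2] := dPhi.
have Phixs : Phi xs = xs by rewrite -YPhi.
(* On [U] the solutions [Y] realize the period map as [Phi], so both sides are its derivative at
   [xs] in the direction [v]. *)
have ME v : v *m M = v + c v *: ev.
  rewrite -dPhi2 -deriveE//; apply/esym/cvg_lim => //.
  apply/cvgrPdist_le => eta eta0.
  have v1 : 0 < 1 + `|v| by rewrite ltr_wpDr.
  have [rho rho0 hrho] := Mlin _ (divr_gt0 eta0 v1).
  have [d d0 hd] := open_normr_ball oU Uxs.
  have m0 : 0 < Num.min rho d / (1 + `|v|) by rewrite divr_gt0// lt_min rho0.
  near=> h.
  have h0 : h != 0 by near: h; exact: nbhs_dnbhs_neq.
  have hm : `|h| < Num.min rho d / (1 + `|v|) by near: h; exact: dnbhs0_lt.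
  have hv : `|h *: v| < Num.min rho d.
    move: hm; rewrite ltr_pdivlMr// normrZ; apply: le_lt_trans.
    by rewrite ler_wpM2l// lerDr.
  move: hv; rewrite lt_min => /andP[hv1 hv2].
  have Uh : U (h *: v + xs) by apply: hd; rewrite addrK.
  have := hrho (Y (h *: v + xs)) (Ysol' _ Uh).
  rewrite (Ys _ Uh) addrK => /(_ hv1); rewrite (YPhi _ Uh) /b xxtau -/xs => H1.
  rewrite /= Phixs distrC.
  have -> : h^-1 *: (Phi (h *: v + xs) - xs) - v *m M =
      h^-1 *: (Phi (h *: v + xs) - xs - h *: v *m M).
    by rewrite [RHS]scalerBr -scalemxAl scalerA mulVf// scale1r.
  rewrite normrZ normfV mulrC ler_pdivrMr ?normr_gt0//.
  apply: (le_trans H1); rewrite normrZ mulrAC ler_pdivrMr//.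
  have : 0 <= eta * `|h| by rewrite mulr_ge0// ltW.
  by move=> eh; rewrite mulrA ler_wpM2l// lerDr.
have detM1 : \det M = 1.
  pose col : 'cV[R]_p.+1 := \col_i c (delta_mx 0 i).
  have clin v : (v *m col) = (c v)%:M.
    apply: linear_form_rV => r u w.
    by rewrite /c linearP /= /dgJ linearP.
  (* The product [ev *m col] is the scalar [c ev], which vanishes, so [col *m ev] has square
     zero. *)
  have -> : M = 1%:M + col *m ev.
    apply/row_matrixP => i; rewrite rowE ME linearD /= row1 row_mul; congr (_ +
        _).
    by rewrite rowE clin mul_scalar_mx.
  rewrite det_add1_square0// mulmxA -[col *m ev *m col]mulmxA clin cev.
  by rewrite raddf0 mulmx0 mul0mx.
move: detM; rewrite detM1 => /esym/eqP.
rewrite -expR0 => /eqP /expR_inj /eqP.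
by rewrite subr_eq0 => /eqP.
Unshelve. all: by end_near. Qed.

End unperturbed.

(** * Integrals depending on a parameter *)



Section dominated.
Variables (R : realType) (a b : R).
Local Notation mu := (@lebesgue_measure R).
Variables (gg : R -> R -> R) (g : R -> R) (e1 B : R).
Hypothesis e10 : 0 < e1.
Hypothesis cgg : forall eps, 0 < `|eps| < e1 -> {within `[a, b], continuous (gg
    eps)}.
Hypothesis bgg : forall eps t, 0 < `|eps| < e1 -> t \in `[a, b] -> `|gg eps t|
    <= B.
Hypothesis gg_g : forall t, t \in `[a, b] -> (fun eps => gg eps t) @ (0 : R)^'
    --> g t.

Lemma integrable_within_continuous (f : R -> R) : {within `[a, b], continuous
    f} ->
  mu.-integrable `[a, b] (EFin \o f).
Proof. by move=> cf; apply: continuous_compact_integrable => //; exact: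
    segment_compact. Qed.

(** Integrability of [g] belongs to the conclusion: [g] is only known as a pointwise limit of
    continuous functions bounded by [B]. *)
Lemma dominated_cvg_seq (eps_ : nat -> R) : (forall k, 0 < `|eps_ k| < e1) ->
  eps_ @ \oo --> 0 ->
  mu.-integrable `[a, b] (EFin \o g) /\
  (fun k => \int[mu]_(t in `[a, b]) gg (eps_ k) t) @ \oo --> \int[mu]_(t in
      `[a, b]) g t.
Proof.
move=> he eps0.
have mI : measurable (`[a, b] : set (measurableTypeR R)) by exact: measurable_itv.
have ig k := integrable_within_continuous (cgg (he k)).
have epsd : eps_ @ \oo --> (0 : R)^'.
  move=> A /nbhs_ballP[r /= r0 hr].
  have n0 : \forall k \near \oo, ball (0 : R) r (eps_ k).
    by apply: eps0; exact: nbhsx_ballx.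
  apply: filterS n0 => k hk; apply: hr => //=.
  by case/andP: (he k); rewrite normr_gt0.
have ggk t : t \in `[a, b] -> (fun k => gg (eps_ k) t) @ \oo --> g t.
  by move=> tab; exact: cvg_comp epsd (gg_g tab).
have ggkE t : `[a, b]%classic t -> (fun k => (gg (eps_ k) t)%:E) @ \oo --> (g
    t)%:E.
  by move=> tab; apply: cvg_EFin; [exact: nearW|exact: ggk].
have iB : mu.-integrable `[a, b] (EFin \o cst B).
  by apply: integrable_within_continuous; apply: continuous_subspaceT => ?;
      exact: cvg_cst.
have mk k := measurable_int mu (ig k).
have mg := measurable_realfun.emeasurable_fun_cvg
  (fun k => EFin \o gg (eps_ k)) (EFin \o g) mk ggkE.
have [||h1 _ h3] := @dominated_convergence _ _ R mu _ mI
  (fun k => EFin \o gg (eps_ k)) (EFin \o g) (EFin \o cst B) mk mg _ iB _.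
- exact: aeW.
- by apply: aeW => t k tab; rewrite /= lee_fin; exact: bgg (he k) tab.
split => //.
have E : (\int[mu]_(t in `[a, b]) (g t)%:E)%E = (\int[mu]_(t in `[a, b]) g t)%:E.
  by rewrite fineK//; exact: integrable_fin_num.
by apply: fine_cvg; rewrite -E.
Qed.

Lemma cvg0_harmonic (eps_ : nat -> R) (c : R) : 0 < c ->
  (forall k, `|eps_ k| <= c / k.+2%:R) -> eps_ @ \oo --> 0.
Proof.
move=> c0 h; apply/cvgr0Pnorm_lt => r r0.
apply: filterS (nbhs_infty_gtr (c / r)) => k; rewrite ltr_pdivrMr// => hk.
apply: (le_lt_trans (h k)); rewrite ltr_pdivrMr// mulrC; apply: (lt_le_trans hk).
by rewrite ler_wpM2r ?(ltW r0)// ler_nat (leq_trans (leqnSn _)).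
Qed.

Lemma Rintegral_cvg0 : mu.-integrable `[a, b] (EFin \o g) /\
  forall eta, 0 < eta -> exists2 e0, 0 < e0 & forall eps, 0 < `|eps| < e0 ->
  `|\int[mu]_(t in `[a, b]) gg eps t - \int[mu]_(t in `[a, b]) g t| < eta.
Proof.
(* With [k.+2] the term for [k = 0] is already strictly below [e1]. *)
have h0 (k : nat) : 0 < e1 / (k.+2)%:R < e1.
  by rewrite divr_gt0//= ltr_pdivrMr// ltr_pMr// ltr1n.
split.
  have [||//] := @dominated_cvg_seq (fun k => e1 / k.+2%:R).
  - by move=> k; rewrite gtr0_norm//; case/andP: (h0 k).
  - by apply: (cvg0_harmonic e10) => k; rewrite gtr0_norm//; case/andP: (h0 k).
(* Otherwise each e1 / (k + 2) admits a parameter violating the bound, and these form a sequence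
   tending to 0. *)
move=> eta eta0; apply: contrapT => hn.
have /choice[eps_ heps] (k : nat) : exists eps, 0 < `|eps| < e1 / k.+2%:R /\
    eta <= `|\int[mu]_(t in `[a, b]) gg eps t - \int[mu]_(t in `[a, b]) g t|.
  apply: contrapT => hk; apply: hn; exists (e1 / k.+2%:R).
    by case/andP: (h0 k).
  move=> eps heps; rewrite ltNge; apply/negP => h; apply: hk.
  by exists eps.
have [||_ hI] := @dominated_cvg_seq eps_.
- move=> k; have [/andP[-> h] _] := heps k.
  by rewrite (lt_trans h)//; case/andP: (h0 k).
- by apply: (cvg0_harmonic e10) => k; have [/andP[_ /ltW]] := heps k.
have /cvgrPdist_lt /(_ _ eta0) [k _ /(_ k (leqnn k))] := hI.
by rewrite /= distrC ltNge => /negP; apply; case: (heps k).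
Qed.

End dominated.

(** * The perturbed vector field *)



Section fields.
Variables (R : realType) (p : nat) (D : set 'rV[R]_p.+1).
Variables (f0 : 'rV[R]_p.+1 -> 'rV[R]_p.+1).
Variable f1 : 'rV[R]_p.+1 -> R -> R -> 'rV[R]_p.+1.
Variable delta : R.
Hypotheses (oD : open D) (delta0 : 0 < delta) (C2f0 : class_C 2 f0 D).
Let F1 (w : 'rV[R]_p.+1 * R * R) := f1 w.1.1 w.1.2 w.2.
Let W : set ('rV[R]_p.+1 * R * R) := [set w | D w.1.1 /\ `|w.2| < delta].
Hypothesis C2f1 : class_C 2 F1 W.
Let e (j : 'I_p.+1) : 'rV[R]_p.+1 := delta_mx 0 j.

Lemma diff_slice y t eps : D y -> `|eps| < delta ->
  is_diff y (fun y => f1 y t eps) (fun v => 'd F1 (y, t, eps) (v, 0, 0)).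
Proof.
move=> Dy he; have Wy : W (y, t, eps) by [].
have [dF1 _] := C2f1.
have h1 := @is_diff_pair _ _ _ _ _ _ _ _ _ (is_diff_id y) (@is_diff_cst _ _ R t
    y).
have h2 := @is_diff_pair _ _ _ _ _ _ _ _ _ h1 (@is_diff_cst _ _ R eps y).
exact: (@is_diff_comp _ _ _ _ _ _ _ _ _ h2 (differentiableP (dF1 _ Wy))).
Qed.

Lemma derive_slice y t eps v : D y -> `|eps| < delta ->
  'D_v (fun y => f1 y t eps) y = 'D_(v, 0, 0) F1 (y, t, eps).
Proof.
move=> Dy he; have [h1 h2] := diff_slice t Dy he.
have [dF1 _] := C2f1; have dF := dF1 (y, t, eps) (conj Dy he).
by rewrite !deriveE// h2.
Qed.

Lemma diff_perturbed y t eps : D y -> `|eps| < delta ->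
  differentiable (perturbed f0 f1 eps t) y.
Proof.
move=> Dy he; have [h1 _] := diff_slice t Dy he.
have [df0 _] := C2f0.
by apply: differentiableD; [exact: df0|exact: differentiableZ].
Qed.

Lemma derive_perturbed y t eps v : D y -> `|eps| < delta ->
  'D_v (perturbed f0 f1 eps t) y = 'D_v f0 y + eps *: 'D_(v, 0, 0) F1 (y, t, eps).
Proof.
move=> Dy he; have [h1 _] := diff_slice t Dy he.
have d0 : derivable f0 y v by apply: diff_derivable; case: C2f0 => + _; exact.
have d1 : derivable (fun y => f1 y t eps) y v by exact: diff_derivable.
rewrite -derive_slice// -(deriveZ _ d1) -deriveD//.
exact: derivableZ.
Qed.

Lemma C1_perturbed eps : `|eps| < delta -> C1_field D (perturbed f0 f1 eps).
Proof.
move=> he t y Dy; split; first exact: diff_perturbed.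
move=> v.
have c0 : {for y, continuous (fun y => 'D_v f0 y)}.
  by apply: differentiable_continuous; case: C2f0 => _ /(_ v)[+ _]; exact.
have c1 : {for (y, t, eps), continuous (fun w => 'D_(v, 0, 0) F1 w)}.
  apply: differentiable_continuous; case: C2f1 => _ /(_ (v, 0, 0))[+ _]; apply.
  by split.
have nD : nbhs (t, y) (fun p : R * 'rV[R]_p.+1 => D p.2).
  by apply: cvg_snd; exact: open_nbhs_nbhs.
have cc : (fun p : R * 'rV[R]_p.+1 => 'D_v f0 p.2 + eps *: 'D_(v, 0, 0) F1
    (p.2, p.1, eps))
    @ (t, y) --> 'D_v f0 y + eps *: 'D_(v, 0, 0) F1 (y, t, eps).
  apply: cvgD; first exact: (cvg_comp (fun q : R * 'rV[R]_p.+1 => q.2) (fun z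
      => 'D_v f0 z) cvg_snd c0).
  apply: cvgZr; apply: cvg_comp_pair c1 => /=; last exact: cvg_cst.
  exact: (cvg_pair (@cvg_snd _ _ (nbhs t) (nbhs y) _) (@cvg_fst _ _ (nbhs t)
      (nbhs y) _)).
suff : (fun q : R * 'rV[R]_p.+1 => 'D_v (perturbed f0 f1 eps q.1) q.2) @ (t, y)
    --> 'D_v (perturbed f0 f1 eps t) y by [].
rewrite derive_perturbed//.
apply: cvg_trans cc; apply: near_eq_cvg.
apply: (@filterS _ _ (nbhs_filter (t, y)) _ _ _ nD) => -[r z] /= Dz.
by rewrite derive_perturbed.
Qed.

(** The space divergence of [f1], expressed through derivatives of the joint map [F1] so that its
    continuity in all variables together is at hand. *)
Definition divergence1 (w : 'rV[R]_p.+1 * R * R) : R :=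
  \sum_i 'D_(e i, 0, 0) F1 w 0 i.

Lemma divergence_perturbed y t eps : D y -> `|eps| < delta ->
  divergence (perturbed f0 f1 eps t) y = divergence f0 y + eps * divergence1
      (y, t, eps).
Proof.
move=> Dy he; rewrite /divergence /divergence1 mulr_sumr -big_split /=.
by apply: eq_bigr => i _; rewrite derive_perturbed// !mxE.
Qed.

Lemma divergence1_continuous y t eps : D y -> `|eps| < delta ->
  {for (y, t, eps), continuous divergence1}.
Proof.
move=> Dy he; apply: (@cvg_big R _ (@GRing.add R) 0 predT _ _ (nbhs (y, t, eps))).
  by move=> /= ?; exact: add_continuous.
move=> i _.
have c1 : {for (y, t, eps), continuous (fun w => 'D_(e i, 0, 0) F1 w)}.
  apply: differentiable_continuous; case: C2f1 => _ /(_ (e i, 0, 0))[+ _]; apply.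
  by split.
exact: (cvg_comp _ _ c1 (@coord_continuous _ _ _ 0 i _)).
Qed.

Lemma F1_continuous y t eps : D y -> `|eps| < delta ->
  {for (y, t, eps), continuous F1}.
Proof.
move=> Dy he; apply: differentiable_continuous; case: C2f1 => + _; apply.
by split.
Qed.

Lemma diff_divergence y : D y -> differentiable (divergence f0) y.
Proof.
move=> Dy; rewrite (_ : divergence f0 = \sum_(i < p.+1) (fun y => 'D_(e i) f0 y
    0 i)).
  apply: differentiable_sum => i.
  apply: (@differentiable_comp _ _ _ _ (fun y => 'D_(e i) f0 y)
    (fun M : 'rV[R]_p.+1 => M 0 i)); last exact: differentiable_coord.
  by case: C2f0 => _ /(_ (e i))[+ _]; exact.
by apply/funext => z; rewrite fct_sumE.
Qed.

Lemma derive_divergence y v : D y ->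
  'D_v (divergence f0) y = \sum_i 'D_v (fun z => 'D_(e i) f0 z) y 0 i.
Proof.
move=> Dy.
have dd i : derivable (fun z => 'D_(e i) f0 z) y v.
  by apply: diff_derivable; case: C2f0 => _ /(_ (e i))[+ _]; exact.
rewrite (_ : divergence f0 = \sum_(i < p.+1) (fun y => 'D_(e i) f0 y 0 i)).
  have dc i : derivable (fun y => 'D_(e i) f0 y 0 i) y v.
    by move/derivable_mxP : (dd i); exact.
  rewrite derive_sum//.
  by apply: eq_bigr => i _; rewrite derive_mx// mxE.
by apply/funext => z; rewrite fct_sumE.
Qed.

(* A field with constant direction, to which the tube estimates for vector
   fields apply. *)
Lemma C1_divergence : C1_field D (fun (_ : R) y => divergence f0 y *: const_mx 1).
Proof.
move=> t y Dy; have dd := diff_divergence.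
split; first by apply: differentiableZl; exact: dd.
move=> v; have E z : D z -> 'D_v (fun y => divergence f0 y *: const_mx 1) z =
    (\sum_i 'D_v (fun z => 'D_(e i) f0 z) z 0 i) *: const_mx 1 :> 'rV[R]_p.+1.
  move=> Dz; rewrite -derive_divergence// !deriveE//; [|exact: dd|].
    by rewrite diffZl//; exact: dd.
  by apply: differentiableZl; exact: dd.
have cc : (fun q : R * 'rV[R]_p.+1 =>
    (\sum_i 'D_v (fun z => 'D_(e i) f0 z) q.2 0 i) *: (const_mx 1 :
        'rV[R]_p.+1)) @ (t, y) -->
    (\sum_i 'D_v (fun z => 'D_(e i) f0 z) y 0 i) *: (const_mx 1 : 'rV[R]_p.+1).
  apply: cvgZl.
  pose h z := \sum_i 'D_v (fun z => 'D_(e i) f0 z) z 0 i.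
  suff hc : h @ y --> h y.
    exact: (cvg_comp (fun q : R * 'rV[R]_p.+1 => q.2) h
      (@cvg_snd _ _ (nbhs t) (nbhs y) _) hc).
  apply: (@cvg_big R _ (@GRing.add R) 0 predT _ _ (nbhs y)).
    by move=> /= ?; exact: add_continuous.
  move=> i _; have c1 : {for y, continuous (fun z => 'D_v (fun z => 'D_(e i) f0
      z) z)}.
    by case: C2f0 => _ /(_ (e i))[_ /(_ v)]; exact.
  exact: (cvg_comp _ _ c1 (@coord_continuous _ _ _ 0 i _)).
suff : (fun q : R * 'rV[R]_p.+1 =>
    'D_v (fun y => divergence f0 y *: const_mx 1) q.2) @ (t, y)
    --> ('D_v (fun y => divergence f0 y *: const_mx 1) y : 'rV[R]_p.+1) by [].
rewrite E//.
apply: cvg_trans cc; apply: near_eq_cvg.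
have nD : nbhs (t, y) (fun p : R * 'rV[R]_p.+1 => D p.2).
  by apply: cvg_snd; exact: open_nbhs_nbhs.
apply: (@filterS _ _ (nbhs_filter (t, y)) _ _ _ nD) => -[r z] /= Dz.
by rewrite E.
Qed.

(** In the trace of the second-derivative term the sum over the diagonal can be taken first, which
    leaves the derivative of the divergence of [f0] along [x1]. The trace is thus the first-order
    expansion in [eps] of the divergence along the perturbed orbit. *)
Lemma trace_variational (xb x1 : R -> 'rV[R]_p.+1) t eps : D (xb t) ->
  \tr (variational_matrix f0 f1 xb x1 t eps) = divergence f0 (xb t) +
   eps * (divergence1 (xb t, t, 0) + 'd (divergence f0) (xb t) (x1 t)).
Proof.
move=> Dx; have h0 : `|0 : R| < delta by rewrite normr0.
have [df0 _] := C2f0; have [ds1 ds2] := diff_slice t Dx h0.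
have trE (A B C : 'M[R]_p.+1) : \tr (A^T + eps *: (B^T + C)) =
    \tr A + eps * (\tr B + \tr C).
  by rewrite mxtraceD mxtraceZ mxtraceD !mxtrace_tr.
rewrite /variational_matrix trE.
congr (_ + _ * (_ + _)).
- by apply: eq_bigr => i _; rewrite mxE deriveE//; exact: df0.
- by apply: eq_bigr => i _; rewrite mxE -deriveE// derive_slice.
rewrite {2}(row_sum_delta (x1 t)) linear_sum /mxtrace.
under eq_bigr do rewrite mxE.
rewrite exchange_big /=; apply: eq_bigr => k _.
rewrite linearZ -deriveE; last exact: diff_divergence.
rewrite derive_divergence//= /GRing.scale/= mulr_sumr.
by apply: eq_bigr => i _; rewrite mulrC.
Qed.

End fields.



(** * Bounds along a curve, primitives and first-order expansions *)

Lemma cvg_comp_triple (T : Type) (U V W X : topologicalType) (G : set_system T)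
    (FG : Filter G) (f : T -> U) (g : T -> V) (k : T -> W) (h : U * V * W -> X)
    (u : U) (v : V) (w : W) :
  f @ G --> u -> g @ G --> v -> k @ G --> w -> {for (u, v, w), continuous h} ->
  (fun s => h (f s, g s, k s)) @ G --> h (u, v, w).
Proof.
move=> fu gv kw hc.
have fg : (fun s => (f s, g s)) @ G --> (u, v) by exact: (cvg_pair fu gv).
exact: (@cvg_comp_pair T (U * V)%type W X G FG _ k h (u, v) w fg kw hc).
Qed.

(** The bound is the maximum on the curve plus 1: compactness gives one radius, for all times,
    within which [h] changes by less than 1. The parameter counts as part of the displacement. *)
Lemma tube_bounded (R : realType) (V W : normedModType R) (h : V * R * R -> W)
    (x : R -> V) (a b : R) : a <= b ->
  (forall t, t \in `[a, b] -> {for t, continuous x}) ->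
  (forall t, t \in `[a, b] -> {for (x t, t, 0), continuous h}) ->
  exists B : R, exists2 r : R, 0 < r & forall (t : R) (v : V) (eps : R), t \in
      `[a, b] ->
  `|v| < r -> `|eps| < r -> `|h (x t + v, t, eps)| <= B.
Proof.
move=> ab cx ch.
have [|c _ hc] := @EVT_max _ (fun t => `|h (x t, t, 0)|) a b ab.
  apply: continuous_within_itv => t tab.
  have cht : (fun s => h (x s, s, 0)) @ t --> h (x t, t, 0).
    exact: (cvg_comp_triple _ (cx t tab) cvg_id (cvg_cst (0 : R)) (ch t tab)).
  exact: (cvg_norm cht).
exists (`|h (x c, c, 0)| + 1).
have /compact_near_coveringP cK := @segment_compact R a b.
pose Q (w : V * R) t := `|h (x t + w.1, t, w.2) - h (x t, t, 0)| < 1.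
suff : nbhs (0 : V * R) (fun w => `[a, b] `<=` Q w).
  move=> /nbhs_ballP[r /= r0 hr]; exists r => // t v eps tab vr er.
  rewrite -[X in `|X|](subrK (h (x t, t, 0))) addrC.
  rewrite (le_trans (ler_normD _ _))// lerD ?hc//.
  apply/ltW/(hr (v, eps)) => //; split => /=.
    by rewrite -ball_normE /ball_/= sub0r normrN.
  by rewrite -ball_normE /ball_/= sub0r normrN.
suff H (t : R) : t \in `[a, b] -> nbhs (t, 0 : V * R) (fun q : R * (V * R) => Q
    q.2 q.1).
  by apply: (cK (V * R)%type (nbhs (0 : V * R)) Q).
move=> tab; rewrite /Q.
have FF : Filter (nbhs (t, 0 : V * R)) by exact: nbhs_filter.
have c0 : (fun q : R * (V * R) => x q.1) @ (t, 0 : V * R) --> x t.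
  by apply: cvg_comp; [exact: cvg_fst|exact: cx].
have c2 : (fun q : R * (V * R) => q.2.1) @ (t, 0 : V * R) --> (0 : V).
  by apply: (cvg_comp (fun q : R * (V * R) => q.2) fst); [exact: cvg_snd|exact:
      cvg_fst].
have c3 : (fun q : R * (V * R) => q.2.2) @ (t, 0 : V * R) --> (0 : R).
  by apply: (cvg_comp (fun q : R * (V * R) => q.2) snd); [exact: cvg_snd|exact:
      cvg_snd].
have c4 : (fun q : R * (V * R) => q.1) @ (t, 0 : V * R) --> t by exact: cvg_fst.
have c1 : (fun q : R * (V * R) => x q.1 + q.2.1) @ (t, 0 : V * R) --> x t.
  by rewrite -[X in _ --> X]addr0; exact: (@cvgD _ _ _ _ FF _ _ _ _ c0 c2).
have h1 := cvg_comp_triple FF c1 c4 c3 (ch t tab).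
have c5 : (fun=> 0 : R) @ nbhs (t, 0 : V * R) --> (0 : R) by exact: cvg_cst.
have h0 := cvg_comp_triple FF c0 c4 c5 (ch t tab).
have := @cvgB _ _ _ _ FF _ _ _ _ h1 h0; rewrite subrr => h10.
exact: (@cvgr0_norm_lt _ _ _ _ FF _ h10 _ ltr01).
Qed.

Lemma divergence_along_continuous (R : realType) n (D : set 'rV[R]_n.+1)
    (F : R -> 'rV[R]_n.+1 -> 'rV[R]_n.+1) (x : R -> 'rV[R]_n.+1) :
  C1_field D F -> solution D F setT x ->
  continuous (fun t => divergence (F t) (x t)).
Proof.
move=> C1F sol t; have [Dx dx] := sol t I.
have cx := is_derive_continuous dx.
apply: (@cvg_big R _ (@GRing.add R) 0 predT _ _ (nbhs t)).
  by move=> /= ?; exact: add_continuous.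
move=> i _; have [_ /(_ (delta_mx 0 i)) c1] := C1F t _ Dx.
have c2 : (fun r => 'D_(delta_mx 0 i) (F r) (x r)) @ t -->
    'D_(delta_mx 0 i) (F t) (x t) by exact: (cvg_comp_pair _ cvg_id cx c1).
exact: (cvg_comp _ _ c2 (@coord_continuous _ _ _ 0 i _)).
Qed.

Section primitive.
Variables (R : realType) (f : R -> R) (s b : R).
Hypotheses (sb : s <= b) (cf : continuous f).

Definition primitive t := \int[lebesgue_measure]_(r in `[s, t]) f r.

Lemma primitive_continuous : {within `[s, b], continuous primitive}.
Proof.
apply: parameterized_integral_continuous => //.
by apply: integrable_within_continuous; exact: continuous_subspaceT.
Qed.

Lemma is_derive_primitive t : t \in `]s, b[ -> is_derive t 1 primitive (f t).
Proof.
rewrite in_itv/= => /andP[st tb].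
have ifs : lebesgue_measure.-integrable `[s, b] (EFin \o f).
  by apply: integrable_within_continuous; exact: continuous_subspaceT.
have cft : {for t, continuous f} by exact: cf.
have [d1 d2] := continuous_FTC1_closed tb ifs st cft.
by split => //; rewrite -derive1E.
Qed.

Lemma primitive_start : primitive s = 0.
Proof. by rewrite /primitive set_itv1 Rintegral_set1. Qed.

End primitive.

Lemma eqO_sqr_bound (R : realType) (V : normedModType R) (f : R -> V) :
  f =O_ (0 : R) (fun eps : R => eps ^+ 2) ->
  exists2 k : R, 0 <= k & exists2 d : R, 0 < d &
  forall eps, `|eps| < d -> `|f eps| <= k * eps ^+ 2.
Proof.
move=> /eqO_exP[k k0 /nbhs_ballP[d /= d0 hd]].
exists k; first exact: ltW.
exists d => // eps he; have := hd eps; rewrite -ball_normE /ball_/= sub0r normrN.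
by move=> /(_ he); rewrite [`|eps ^+ 2|]ger0_norm ?sqr_ge0.
Qed.

Lemma is_derive_expansion (R : realType) (V : normedModType R) (y : R -> V) (y1
    : V) :
  (fun eps : R => y eps - y 0 - eps *: y1) =O_ (0 : R) (fun eps : R => eps ^+
      2) ->
  is_derive (0 : R) 1 y y1.
Proof.
move=> /eqO_sqr_bound[k k0 [d d0 hd]].
have lim1 : (fun h : R => h^-1 *: ((y \o shift 0) (h *: 1) - y 0)) @ 0^' --> y1.
  apply/cvgrPdist_le => eta eta0; near=> h.
  have h0 : h != 0 by near: h; exact: nbhs_dnbhs_neq.
  have hdl : `|h| < d by near: h; exact: dnbhs0_lt.
  have hk : `|h| < eta / (k + 1).
    by near: h; apply: dnbhs0_lt; rewrite divr_gt0// ltr_wpDl.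
  rewrite distrC /= /shift addr0 [h *: 1]mulr1.
  have -> : h^-1 *: (y h - y 0) - y1 = h^-1 *: (y h - y 0 - h *: y1).
    by rewrite [RHS]scalerBr scalerA mulVf// scale1r.
  rewrite normrZ normfV mulrC ler_pdivrMr ?normr_gt0// (le_trans (hd _ hdl))//.
  rewrite -real_normK ?num_real// expr2 mulrA ler_wpM2r//.
  move: hk; rewrite ltr_pdivlMr ?ltr_wpDl// => /ltW; apply: le_trans.
  by rewrite mulrC ler_wpM2l// lerDl.
by split; [apply/cvg_ex; exists y1|exact: cvg_lim].
Unshelve. all: by end_near. Qed.

Lemma is_derive_diff_comp (R : realType) (V W : normedModType R) (f : V -> W)
    (y : R -> V) (t : R) (dy : V) :
  is_derive t 1 y dy -> differentiable f (y t) ->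
  is_derive t 1 (f \o y) ('d f (y t) dy).
Proof.
move=> [y1 y2] df.
have dfy : differentiable y t by exact/derivable1_diffP.
have dc : differentiable (f \o y) t by exact: differentiable_comp.
by split; [exact/derivable1_diffP|rewrite deriveE// diff_comp//= -y2 deriveE].
Qed.

Lemma is_derive_quotient_cvg (R : realType) (V : normedModType R) (y : R -> V)
    (dy : V) :
  is_derive (0 : R) 1 y dy -> (fun h => h^-1 *: (y h - y 0)) @ (0 : R)^' --> dy.
Proof.
move=> [d <-]; apply: cvg_trans d; apply: near_eq_cvg; near=> h.
by rewrite /= /shift addr0 [h *: 1]mulr1.
Unshelve. all: by end_near. Qed.

(** * The bifurcating family *)



Section family.
Variables (R : realType) (p : nat) (D : set 'rV[R]_p.+1).
Variables (f0 : 'rV[R]_p.+1 -> 'rV[R]_p.+1).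
Variable f1 : 'rV[R]_p.+1 -> R -> R -> 'rV[R]_p.+1.
Variable delta : R.
Hypotheses (oD : open D) (delta0 : 0 < delta) (C2f0 : class_C 2 f0 D).
Hypothesis C2f1 : class_C 2 (fun w : 'rV[R]_p.+1 * R * R => f1 w.1.1 w.1.2 w.2)
    [set w | D w.1.1 /\ `|w.2| < delta].
Variables (x : R -> R -> 'rV[R]_p.+1) (x1 : R -> 'rV[R]_p.+1) (d : R).
Hypothesis d0 : 0 < d.
Hypothesis solx : forall eps, `|eps| < d -> solution D (perturbed f0 f1 eps)
    setT (x eps).
Hypothesis expansion : forall t, (fun eps : R => x eps t - x 0 t - eps *: x1 t)
  =O_ (0 : R) (fun eps : R => eps ^+ 2).
Variables (a b : R).
Hypothesis ab : a <= b.

Let F1 (w : 'rV[R]_p.+1 * R * R) := f1 w.1.1 w.1.2 w.2.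

Lemma unperturbed_solution : solution D (fun=> f0) setT (x 0).
Proof.
move=> t _; have [|//|Dx dx] := @solx 0 _ t; first by rewrite normr0.
by split=> //; move: dx; rewrite /perturbed scale0r addr0.
Qed.

Let Dx0 t : D (x 0 t).
Proof. by have [] := unperturbed_solution (t := t). Qed.

Let cx0 t : {for t, continuous (x 0)}.
Proof.
by have [//|_ dx] := unperturbed_solution (t := t); exact: is_derive_continuous
    dx.
Qed.

Lemma C1_unperturbed : C1_field D (fun=> f0).
Proof.
have h0 : `|0 : R| < delta by rewrite normr0.
move=> t y Dy; have := C1_perturbed oD C2f0 C2f1 h0 t Dy.
by rewrite (_ : perturbed f0 f1 0 = (fun=> f0))//;
  apply/funext => r; apply/funext => z; rewrite /perturbed scale0r addr0.
Qed.

(** The expansion, whose constants depend on the time, is used at [a] alone. Gronwall's estimate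
    propagates the resulting bound over the interval, the perturbation acting as a forcing of size
    |eps| |B|. *)
Lemma family_close : exists C, exists2 e1, 0 < e1 & forall eps t,
  `|eps| < e1 -> t \in `[a, b] -> `|x eps t - x 0 t| <= C * `|eps|.
Proof.
have [k k0 [d1 d10 hd1]] := eqO_sqr_bound (expansion a).
have Dx0' t : t \in `[a, b] -> D (x 0 t) by move=> _; exact: Dx0.
have cx0' t : t \in `[a, b] -> {for t, continuous (x 0)} by move=> _; exact: cx0.
have [L L0 hL] := diff_bounded C1_unperturbed ab Dx0' cx0'.
have [r r0 hr] := tube_linear oD C1_unperturbed Dx0' cx0' ltr01.
have [|B [r2 r20 hB]] := @tube_bounded _ _ _ F1 (x 0) a b ab cx0'.
  move=> t tab; have h0 : `|0 : R| < delta by rewrite normr0.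
  exact: (F1_continuous C2f1 (Dx0 t) h0).
pose G := gronwall_constant p (L + 1) (b - a).
have G0 : 0 < G.
  apply: lt_le_trans ltr01 _; apply: gronwall_constant_ge1; rewrite ?subr_ge0//.
  by rewrite addr_ge0.
pose K := `|x1 a| + k + `|B|.
have K0 : 0 <= K by rewrite !addr_ge0.
pose m := Num.min r r2 / 2.
have m0 : 0 < m by rewrite divr_gt0// lt_min r0.
have mr : m < r by rewrite ltr_pdivrMr// (@le_lt_trans _ _ r) ?ge_min ?lexx//
    ltr_pMr// ltr1n.
have mr2 : m < r2.
  by rewrite ltr_pdivrMr// (@le_lt_trans _ _ r2) ?ge_min ?lexx ?orbT//
      ltr_pMr// ltr1n.
have GK : 0 < G * K + 1 by rewrite ltr_wpDl// mulr_ge0// ltW.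
(* In order: [x eps] is a solution, the expansion at [a] holds, [f1] is bounded by [B], eps^2 <=
   |eps|, and the final estimate stays below the bootstrap radius [m]. *)
pose e1 := Num.min (Num.min d d1) (Num.min (Num.min r2 1) (m / (G * K + 1))).
have e10 : 0 < e1 by rewrite !lt_min d0 d10 r20 ltr01 divr_gt0.
exists (G * K), e1 => // eps t; rewrite !lt_min.
move=> /andP[/andP[ed ed1] /andP[/andP[er2 e_1] em]] tab.
have va : `|x eps a - x 0 a| <= (`|x1 a| + k) * `|eps|.
  rewrite -[X in `|X|](subrK (eps *: x1 a)) (le_trans (ler_normD _ _))//.
  rewrite addrC mulrDl normrZ mulrC lerD2l (le_trans (hd1 _ ed1))//.
  by rewrite ler_wpM2l// -real_normK ?num_real// expr2 ler_piMr// ltW.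
have Gm : G * (`|x eps a - x 0 a| + `|eps| * `|B|) <= G * K * `|eps|.
  rewrite -mulrA; apply: ler_wpM2l; first exact: ltW.
  by rewrite /K [leRHS]mulrDl lerD// mulrC.
apply: le_trans Gm.
apply: (@gronwall_bootstrap _ p (fun t => x eps t - x 0 t)
  (fun t => perturbed f0 f1 eps t (x eps t) - f0 (x 0 t)) (L + 1) (`|eps| * `|B|)
  m a b ab) => //.
- by rewrite addr_ge0.
- move=> s sab; have [//|_ h1] := solx ed (t := s).
  have [//|_ h2] := unperturbed_solution (t := s).
  exact: (@is_deriveB R R _ (x eps) (x 0) _ _ _ _ h1 h2).
- move=> s sab hs.
  have sr : `|x eps s - x 0 s| < r by exact: le_lt_trans mr.
  have sr2 : `|x eps s - x 0 s| < r2 by exact: le_lt_trans mr2.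
  have [_] := hr s _ sab sr; rewrite mul1r [x 0 s + _]addrC subrK => H1.
  have := hB s _ eps sab sr2 er2; rewrite [x 0 s + _]addrC subrK /F1/= => H2.
  rewrite /perturbed addrAC (le_trans (ler_normD _ _))// lerD//; last first.
    by rewrite normrZ ler_wpM2l// (le_trans H2)// ler_norm.
  rewrite -[X in `|X|](subrK ('d f0 (x 0 s) (x eps s - x 0 s))).
  apply: (le_trans (ler_normD _ _)); rewrite mulrDl mul1r [leLHS]addrC lerD//.
  exact: (hL s _ sab).
- apply: (@le_lt_trans _ _ (G * K * `|eps|)).
    rewrite -mulrA; apply: ler_wpM2l; first exact: ltW.
    by rewrite /K [leRHS]mulrDl lerD// mulrC.
  apply: (@le_lt_trans _ _ ((G * K + 1) * `|eps|)); first by rewrite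
      ler_wpM2r// lerDl.
  by rewrite mulrC -ltr_pdivlMr.
Qed.

Let g t := divergence1 f1 (x 0 t, t, 0) + 'd (divergence f0) (x 0 t) (x1 t).
Let gg eps t := eps^-1 *
  (divergence (perturbed f0 f1 eps t) (x eps t) - divergence f0 (x 0 t)).

(** For small nonzero [eps] the quotient is the divergence of [f1] at [x eps t] plus the difference
    quotient of the divergence of [f0] along a curve with velocity [x1 t] at [eps = 0]. *)
Lemma divergence_quotient_cvg t :
  (fun eps => gg eps t) @ (0 : R)^' --> g t.
Proof.
have dxt := is_derive_expansion (expansion t).
have cxt := is_derive_continuous dxt.
have ddiv : differentiable (divergence f0) (x 0 t).
  exact: (diff_divergence C2f0 (Dx0 t)).
have q1 : (fun eps : R => eps^-1 * (divergence f0 (x eps t) - divergence f0 (x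
    0 t)))
    @ 0^' --> 'd (divergence f0) (x 0 t) (x1 t).
  exact: (is_derive_quotient_cvg (is_derive_diff_comp dxt ddiv)).
have q2 : (fun eps : R => divergence1 f1 (x eps t, t, eps)) @ 0^' -->
    divergence1 f1 (x 0 t, t, 0).
  have h0 : `|0 : R| < delta by rewrite normr0.
  have cd := divergence1_continuous C2f1 (Dx0 t) h0.
  have c1 : (fun eps => x eps t) @ (0 : R)^' --> x 0 t.
    by apply: cvg_within_filter; exact: cxt.
  have c2 : (id : R -> R) @ (0 : R)^' --> (0 : R).
    by apply: cvg_within_filter; exact: cvg_id.
  have c3 : (fun _ : R => t) @ (0 : R)^' --> t by exact: cvg_cst.
  exact: (cvg_comp_triple _ c1 c3 c2 (cd t)).
have q3 : (fun eps : R => divergence1 f1 (x eps t, t, eps) + eps^-1 *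
    (divergence f0 (x eps t) - divergence f0 (x 0 t))) @ (0 : R)^' --> g t.
  exact: (cvgD q2 q1).
apply: cvg_trans q3; apply: near_eq_cvg; near=> eps.
have e0 : eps != 0 by near: eps; exact: nbhs_dnbhs_neq.
have ed : `|eps| < d by near: eps; exact: dnbhs0_lt.
have edl : `|eps| < delta by near: eps; exact: dnbhs0_lt.
have [//|De _] := solx ed (t := t).
rewrite /gg (divergence_perturbed C2f0 C2f1 t De edl) /=.
by field.
Unshelve. all: by end_near. Qed.

(** The domination for the limit under the integral: the distance of order |eps| from [family_close]
    compensates for the division by [eps], uniformly in time. *)
Lemma divergence_quotient_bounded : exists B, exists2 e1, 0 < e1 & forall eps t,
  0 < `|eps| < e1 -> t \in `[a, b] -> `|gg eps t| <= B.
Proof.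
have [C [e1 e10 hC]] := family_close.
have Dx0' t : t \in `[a, b] -> D (x 0 t) by move=> _; exact: Dx0.
have cx0' t : t \in `[a, b] -> {for t, continuous (x 0)} by move=> _; exact: cx0.
have C1d := C1_divergence oD C2f0.
have [L L0 hL] := diff_bounded C1d ab Dx0' cx0'.
have [r r0 hr] := tube_linear oD C1d Dx0' cx0' ltr01.
have [|B [r2 r20 hB]] := @tube_bounded _ _ _ (divergence1 f1) (x 0) a b ab cx0'.
  move=> t tab; have h0 : `|0 : R| < delta by rewrite normr0.
  exact: (divergence1_continuous C2f1 (Dx0 t) h0).
pose C' := `|C| + 1.
have C'0 : 0 < C' by rewrite ltr_wpDl.
pose m := Num.min r r2.
have m0 : 0 < m by rewrite lt_min r0.
exists ((L + 1) * C' + B).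
exists (Num.min (Num.min e1 (m / C')) (Num.min (Num.min d delta) r2)).
  by rewrite !lt_min e10 divr_gt0// d0 delta0.
move=> eps t; rewrite !lt_min.
move=> /andP[e0 /andP[/andP[ee1 em] /andP[/andP[ed edl] er2]]] tab.
have [//|De _] := solx ed (t := t).
have close : `|x eps t - x 0 t| <= C' * `|eps|.
  by rewrite (le_trans (hC _ _ ee1 tab))// ler_wpM2r// (le_trans (ler_norm
      C))// lerDl.
have closem : `|x eps t - x 0 t| < m.
  by apply: (le_lt_trans close); rewrite mulrC -ltr_pdivlMr.
move: closem; rewrite lt_min => /andP[sr sr2].
have n0 : eps != 0 by rewrite -normr_gt0.
rewrite /gg (divergence_perturbed C2f0 C2f1 t De edl).
rewrite addrAC normrM normfV mulrC ler_pdivrMr// mulrDl.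
rewrite (le_trans (ler_normD _ _))// lerD//; last first.
  rewrite normrM mulrC ler_wpM2r//.
  by have := hB t _ eps tab sr2 er2; rewrite [x 0 t + _]addrC subrK.
rewrite -mulrA.
have [_] := hr t _ tab sr; rewrite mul1r [x 0 t + _]addrC subrK => H1.
pose w : 'rV[R]_p.+1 := const_mx 1.
apply: (@le_trans _ _ `|divergence f0 (x eps t) *: w - divergence f0 (x 0 t) *:
    w|).
  rewrite -scalerBl; have := normr_rV_coord
    ((divergence f0 (x eps t) - divergence f0 (x 0 t)) *: w) 0.
  by rewrite !mxE mulr1.
rewrite -[X in `|X|](subrK ('d (fun y => divergence f0 y *: w) (x 0 t) (x eps t
    - x 0 t))).
rewrite (le_trans (ler_normD _ _))// addrC mulrDl mul1r lerD//; last first.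
  exact: le_trans H1 close.
by rewrite (le_trans (hL t _ tab))// ler_wpM2l.
Qed.

Lemma divergence_family_continuous eps : `|eps| < d -> `|eps| < delta ->
  continuous (fun t => divergence (perturbed f0 f1 eps t) (x eps t)).
Proof.
move=> ed edl; apply: divergence_along_continuous (solx ed).
exact: (C1_perturbed oD C2f0 C2f1 edl).
Qed.

Lemma divergence_unperturbed_continuous : continuous (fun t => divergence f0 (x
    0 t)).
Proof. exact: (divergence_along_continuous C1_unperturbed
    unperturbed_solution). Qed.

(** The link with [lambda]: by [trace_variational], [g] is the coefficient of [eps] in the trace of
    the variational matrix. Its integrability is needed to split the integral that defines
    [lambda]. *)
Lemma family_integral_expansion :
  lebesgue_measure.-integrable `[a, b] (EFin \o g) /\
  forall eta, 0 < eta -> exists2 e0, 0 < e0 & forall eps, 0 < `|eps| < e0 ->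
  `|eps^-1 * (primitive (fun t => divergence (perturbed f0 f1 eps t) (x eps t))
      a b -
     primitive (fun t => divergence f0 (x 0 t)) a b) - primitive g a b| < eta.
Proof.
have [B [e1 e10 hB]] := divergence_quotient_bounded.
pose e2 := Num.min e1 (Num.min d delta).
have e20 : 0 < e2 by rewrite !lt_min e10 d0.
have ecase (eps : R) : 0 < `|eps| < e2 -> [/\ 0 < `|eps| < e1, `|eps| < d &
    `|eps| < delta].
  by rewrite /e2 !lt_min => /andP[-> /and3P[-> -> ->]].
have cgg (eps : R) : 0 < `|eps| < e2 -> continuous (gg eps).
  move=> /ecase[_ ed edl] t; apply: cvgM; first exact: cvg_cst.
  apply: cvgB; first exact: divergence_family_continuous.
  exact: divergence_unperturbed_continuous.
have [|||ig hg] := @Rintegral_cvg0 R a b gg g e2 B e20.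
- by move=> eps he; exact: continuous_subspaceT (cgg eps he).
- by move=> eps t /ecase[he _ _]; exact: hB.
- by move=> t _; exact: divergence_quotient_cvg.
split => // eta eta0; have [e3 e30 he3] := hg eta eta0.
exists (Num.min e3 e2); first by rewrite lt_min e30.
move=> eps; rewrite lt_min => /andP[eps0 /andP[h3 h2]].
have [_ ed edl] := ecase eps (introT andP (conj eps0 h2)).
have mI : measurable (`[a, b] : set (measurableTypeR R)) by exact: measurable_itv.
have int_cont (f : R -> R) : continuous f ->
    lebesgue_measure.-integrable `[a, b] (EFin \o f).
  by move=> cf; apply: integrable_within_continuous; exact: continuous_subspaceT.
have i1 := int_cont _ (divergence_family_continuous ed edl).
have i2 := int_cont _ divergence_unperturbed_continuous.
have i3 : lebesgue_measure.-integrable `[a, b] (EFin \o (fun t =>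
    divergence (perturbed f0 f1 eps t) (x eps t) - divergence f0 (x 0 t))).
  apply: int_cont => t; apply: cvgB; first exact: divergence_family_continuous.
  exact: divergence_unperturbed_continuous.
have := he3 eps; rewrite eps0 h3 => /(_ isT).
by rewrite /gg (RintegralZl _ mI i3) (RintegralB mI i1 i2).
Qed.

End family.

Unset Implicit Arguments.
Set Strict Implicit.
Set Printing Implicit Defensive.

Theorem corollary1 (R : realType) (p : nat) (D : set 'rV[R]_p.+1)
  (f0 : 'rV[R]_p.+1 -> 'rV[R]_p.+1)
  (f1 : 'rV[R]_p.+1 -> R -> R -> 'rV[R]_p.+1)
  (delta T : R)
  (I : 'rV[R]_p.+1 -> 'rV[R]_p) (P : 'rV[R]_p.+1 -> R)
  (D0 : set 'rV[R]_p.+1) (x0 : 'rV[R]_p -> 'rV[R]_p.+1)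
  (q : 'rV[R]_p -> R -> 'rV[R]_p.+1)
  (m n : nat) (z : 'rV[R]_p * R)
  (x : R -> R -> 'rV[R]_p.+1) (x1 : R -> 'rV[R]_p.+1) (t0 : R) :
  open D ->
  class_C 2 f0 D ->
  0 < delta ->
  class_C 2 (fun w : 'rV[R]_p.+1 * R * R => f1 w.1.1 w.1.2 w.2)
    [set w | D w.1.1 /\ `|w.2| < delta] ->
  0 < T ->
  (forall y eps, D y -> `|eps| < delta -> periodic (fun t => f1 y t eps) T) ->
  completely_integrable D f0 I ->
  levels_of_closed_orbits D f0 I ->
  C1_period D f0 P ->
  (exists y k l, [/\ D y, k != 0%N, l != 0%N & k%:R * P y = l%:R * T]) ->
  global_section D f0 D0 ->
  (forall xi, (I @` D) xi -> level_set D I xi `&` D0 = [set x0 xi]) ->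
  (forall xi, (I @` D) xi ->
     solution D (fun=> f0) setT (q xi) /\ q xi 0 = x0 xi) ->
  circle_diffeomorphism T (I @` D) D (action_angle T P x0 q) ->
  existence_conditions T (I @` D) f0 f1 I P x0 q m n z ->
  periodic_family D f0 f1 (n%:R * T) (action_angle T P x0 q z) x x1 ->
  exists2 eps0 : R, 0 < eps0 & forall eps, 0 < `|eps| < eps0 ->
    0 < lambda f0 f1 (x 0) x1 (n%:R * T) t0 eps ->
    lyapunov_unstable D (perturbed f0 f1 eps) (x eps).
Proof.
move=> oD C2f0 delta0 C2f1 T0 f1T _ _ CP _ _ _ solq diffeoG.
move=> [_ _ n0 _ _] [nearsol _ expansion].
pose tau := n%:R * T; have tau0 : 0 < tau by rewrite mulr_gt0// ltr0n lt0n.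
pose b := t0 + tau; have t0b : t0 <= b by rewrite lerDl ltW.
have [d d0 hd] : exists2 d, 0 < d & forall eps : R, `|eps| < d ->
    solution D (perturbed f0 f1 eps) setT (x eps) /\ periodic (x eps) tau.
  move/nbhs_ballP : nearsol => [d /= d0 hd]; exists d => // eps he.
  by apply: hd; rewrite -ball_normE /ball_/= sub0r normrN.
have solx eps : `|eps| < d -> solution D (perturbed f0 f1 eps) setT (x eps).
  by move=> /hd[].
have sol0 := unperturbed_solution d0 solx.
have C1f0 := C1_unperturbed oD delta0 C2f0 C2f1.
have [ig hexp] := family_integral_expansion oD delta0 C2f0 C2f1 d0 solx expansion t0b.
set g := (fun t : R => _ + _) in ig hexp.
have cdiv0 := divergence_unperturbed_continuous oD delta0 C2f0 C2f1 d0 solx.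
have per0 : periodic (x 0) tau by have [] := hd 0; rewrite ?normr0.
pose phi0 := primitive (fun t => divergence f0 (x 0 t)) t0.
have trace0 : phi0 b = 0.
  rewrite -[RHS](primitive_start (fun t => divergence f0 (x 0 t)) t0).
  apply: (unperturbed_trace T0 oD CP solq diffeoG C1f0 tau0 sol0 per0).
    exact: primitive_continuous.
  by move=> t tab; exact: (is_derive_primitive cdiv0 tab).
pose c := primitive g t0 b.
have mI : measurable (`[t0, b] : set (measurableTypeR R)) by exact: measurable_itv.
have lambdaE eps : lambda f0 f1 (x 0) x1 tau t0 eps = tau^-1 * (eps * c).
  rewrite /lambda; congr (_ * _).
  have -> : \int[lebesgue_measure]_(t in `[t0, t0 + tau])
      \tr (variational_matrix f0 f1 (x 0) x1 t eps) =
      \int[lebesgue_measure]_(t in `[t0, b]) (divergence f0 (x 0 t) + eps * g t).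
    apply: eq_Rintegral => t _; apply: (trace_variational delta0 C2f0 C2f1).
    by have [] := sol0 t Logic.I.
  have i0 : lebesgue_measure.-integrable `[t0, b]
      (EFin \o (fun t => divergence f0 (x 0 t))).
    by apply: integrable_within_continuous; exact: continuous_subspaceT.
  have ieg : lebesgue_measure.-integrable `[t0, b] (EFin \o (fun t => eps * g t)).
    exact: (integrableZl mI eps ig).
  rewrite (RintegralD mI i0 ieg) (RintegralZl _ mI ig).
  by rewrite [X in X + _](trace0 : _ = 0) add0r.
(* If [c] vanishes, so does [lambda] for every [eps], and its positivity is contradictory. *)
have [c0|c0] := eqVneq c 0.
  exists 1 => // eps _; rewrite lambdaE c0 !mulr0 ltxx.
  by [].
(* The tolerance |c| is what forces the quotient to have the sign of [c]; the threshold depends on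
   [c] only and not on the sign of [eps]. *)
have [e3 e30 he3] : exists2 e0, 0 < e0 & forall eps, 0 < `|eps| < e0 ->
    `|eps^-1 * (primitive (fun t => divergence (perturbed f0 f1 eps t) (x eps t)) t0 b -
      phi0 b) - c| < `|c|.
  by apply: hexp; rewrite normr_gt0.
exists (Num.min e3 (Num.min d delta)); first by rewrite !lt_min e30 d0.
move=> eps; rewrite !lt_min => /andP[eps0 /and3P[ee3 ed edl]].
rewrite lambdaE pmulr_rgt0 ?invr_gt0// => epsc.
have [solE perE] := hd eps ed.
have C1F := C1_perturbed oD C2f0 C2f1 edl.
have cdiv := divergence_along_continuous C1F solE.
pose phi := primitive (fun t => divergence (perturbed f0 f1 eps t) (x eps t)) t0.
apply: (@unstable_of_expanding_volume R p D _ (x eps) t0 tau phi oD C1F tau0) => //.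
- move=> t y Dy; rewrite /perturbed /tau mulr_natl; congr (_ + _ *: _).
  by have := f1T y eps Dy edl => /periodicn; exact.
- exact: primitive_continuous.
- by move=> t tab; exact: (is_derive_primitive cdiv tab).
rewrite /phi primitive_start -/b.
have := he3 eps; rewrite eps0 ee3 => /(_ isT).
rewrite trace0 subr0.
set Phi := phi b => hPhi.
have epsn0 : eps != 0 by rewrite -normr_gt0.
set q_ := eps^-1 * Phi in hPhi.
(* Squaring |q - c| < |c| gives q^2 < 2 q c. Multiplied by eps c > 0, the product q c becomes Phi
   c^2, so [Phi] is positive. *)
have qc : 0 < q_ * c.
  have : `|q_ - c| ^+ 2 < `|c| ^+ 2 by rewrite ltrXn2r// ?nnegrE.
  by rewrite !real_normK ?num_real//; have := sqr_ge0 q_; nra.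
have : 0 < (eps * c) * (q_ * c) by rewrite mulr_gt0.
have -> : (eps * c) * (q_ * c) = Phi * c ^+ 2 by rewrite /q_; field.
by rewrite pmulr_lgt0// exprn_even_gt0.
Qed.
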